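(* Let $\Lambda_1$ and $\Lambda_2$ be two lattices in $\mathbb{R}^n$, let $\alpha,\beta>0$ and $1\le p\le n$. Then $F_{\alpha\beta,p}^{\mathbb{R}^n/\Lambda_1}$ and $F_{\alpha\beta,p}^{\mathbb{R}^n/\Lambda_2}$ are isospectral if and only if $\Delta_0^{\mathbb{R}^n/\Lambda_1}$ and $\Delta_0^{\mathbb{R}^n/\Lambda_2}$ are isospectral.
   Context: A lattice in $\mathbb{R}^n$ is the $\mathbb{Z}$-span of a basis of $\mathbb{R}^n$; $\mathbb{R}^n/\Lambda$ carries the flat metric induced by the standard metric of $\mathbb{R}^n$. For a compact Riemannian manifold $M$, $d$ is the exterior derivative, $\delta$ its formal $L^2$-adjoint, $F_{\alpha\beta,p}^M:=\alpha d\delta+\beta\delta d$ on smooth $p$-forms $\Omega^p(M)$, and $\Delta_0^M=\delta d$ is the Laplacian on smooth functions. The spectrum of such an operator is the function assigning to each $\lambda\in\mathbb{C}$ the dimension of its eigenspace for $\lambda$ in the smooth forms (resp. functions), i.e. eigenvalues counted with multiplicity. Two operators are isospectral if their spectra (with multiplicities) coincide. *)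

(* Defs.v *)
From mathcomp Require Import all_boot all_order all_algebra.
From mathcomp Require Import complex.
From mathcomp Require Import all_classical all_reals all_analysis.

Set Implicit Arguments.
Unset Strict Implicit.
Unset Printing Implicit Defensive.

Import Order.TTheory GRing.Theory Num.Theory.
Import numFieldNormedType.Exports.

Local Open Scope classical_set_scope.
Local Open Scope complex_scope.
Local Open Scope ring_scope.

(* Vectors of R^n are row vectors. *)

Definition Zspan (R : realType) (n : nat) (B : 'M[R]_n) : set 'rV[R]_n :=
  [set x | exists c : 'I_n -> int, x = \sum_i (c i)%:~R *: row i B].

Definition is_basis_of_lattice (R : realType) (n : nat) (L : set 'rV[R]_n)
    (B : 'M[R]_n) : Prop :=
  B \in unitmx /\ L = Zspan B.

Definition is_lattice (R : realType) (n : nat) (L : set 'rV[R]_n) : Prop :=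
  exists B : 'M[R]_n, is_basis_of_lattice L B.

Definition lattice_basis (R : realType) (n : nat) (L : set 'rV[R]_n) :
    'M[R]_n :=
  xget 1%:M (is_basis_of_lattice L).

(* Smooth functions on R^n / L are identified with smooth L-periodic functions
   on R^n; values are complex since eigenvalues range over C. *)

Definition partial (R : realType) (n : nat) (j : 'I_n) (f : 'rV[R]_n -> R) :
    'rV[R]_n -> R :=
  fun x => 'D_(delta_mx ord0 j) f x.

Fixpoint Ck (R : realType) (n k : nat) (f : 'rV[R]_n -> R) : Prop :=
  continuous f /\
  if k is k'.+1 then
    forall j : 'I_n,
      (forall x, derivable f x (delta_mx ord0 j)) /\ Ck k' (partial j f)
  else True.

Definition smooth (R : realType) (n : nat) (f : 'rV[R]_n -> R) : Prop :=
  forall k, Ck k f.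

Definition csmooth (R : realType) (n : nat) (f : 'rV[R]_n -> R[i]) : Prop :=
  smooth (fun x => complex.Re (f x)) /\ smooth (fun x => complex.Im (f x)).

Definition cpartial (R : realType) (n : nat) (j : 'I_n)
    (f : 'rV[R]_n -> R[i]) : 'rV[R]_n -> R[i] :=
  fun x => partial j (fun y => complex.Re (f y)) x +i* partial j (fun y => complex.Im (f y)) x.

Definition periodic (R : realType) (n : nat) (L : set 'rV[R]_n)
    (f : 'rV[R]_n -> R[i]) : Prop :=
  forall v x, L v -> f (x + v) = f x.

(* A differential form of mixed degree on R^n, given by its coefficients in the
   global frame dx_I = dx_{i_1} /\ ... /\ dx_{i_p}, where
   I = {i_1 < ... < i_p}: w stands for \sum_I w_I dx_I. *)
Definition dform (R : realType) (n : nat) : Type :=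
  {set 'I_n} -> 'rV[R]_n -> R[i].

Definition Omega_all (R : realType) (n : nat) (L : set 'rV[R]_n) :
    set (dform R n) :=
  [set w | forall I, csmooth (w I) /\ periodic L (w I)].

Definition Omega (R : realType) (n : nat) (L : set 'rV[R]_n) (p : nat) :
    set (dform R n) :=
  [set w | Omega_all L w /\ forall I : {set 'I_n}, #|I| <> p -> w I = 0].

(* d (f dx_I) = \sum_j (partial_j f) dx_j /\ dx_I; for j not in I,
   dx_j /\ dx_I = (-1)^#{i in I | i < j} dx_{I U {j}}. *)
Definition extd (R : realType) (n : nat) (w : dform R n) : dform R n :=
  fun J x => \sum_(j in J)
    (-1) ^+ #|[set i in J | (i < j)%N]| * cpartial j (w (J :\ j)) x.

(* For continuous f, the Lebesgue integral over [0, 1]^n, by Fubini *)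
Fixpoint cube_integral (R : realType) (n : nat) : ('rV[R]_n -> R) -> R :=
  if n is n'.+1 return ('rV[R]_n -> R) -> R then
    fun f => Rintegral lebesgue_measure `[0%R, 1%R]
      (fun t : R => cube_integral (fun v : 'rV[R]_n' =>
         f (row_mx (t%:M : 'rV[R]_1) v)))
  else fun f => f 0.

(* Integral over R^n / L for the Riemannian volume of the flat metric, computed
   on the fundamental domain [0, 1]^n *m B for a basis B of L *)
Definition torus_integral (R : realType) (n : nat) (L : set 'rV[R]_n)
    (f : 'rV[R]_n -> R) : R :=
  `|\det (lattice_basis L)|
    * cube_integral (fun t => f (t *m lattice_basis L)).

(* Hermitian pointwise inner product; the dx_I are orthonormal. *)
Definition pointwise_inner (R : realType) (n : nat) (w e : dform R n) :
    'rV[R]_n -> R[i] :=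
  fun x => \sum_I w I x * (e I x)^*.

Definition L2_inner (R : realType) (n : nat) (L : set 'rV[R]_n)
    (w e : dform R n) : R[i] :=
  torus_integral L (fun x => complex.Re (pointwise_inner w e x))
    +i* torus_integral L (fun x => complex.Im (pointwise_inner w e x)).

(* The formal L^2-adjoint of d: codiff L e is the form z (unique, for e smooth
   and periodic) such that (d w, e) = (w, z) for every smooth form w on
   R^n / L.  Forms of distinct degrees being orthogonal, it maps p.+1-forms to
   p-forms and functions to 0. *)
Definition codiff (R : realType) (n : nat) (L : set 'rV[R]_n) (e : dform R n) :
    dform R n :=
  xget 0 [set z | Omega_all L z /\
    forall w, Omega_all L w -> L2_inner L (extd w) e = L2_inner L w z].

Definition F_op (R : realType) (n : nat) (alpha beta : R) (L : set 'rV[R]_n)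
    (w : dform R n) : dform R n :=
  alpha%:C *: extd (codiff L w) + beta%:C *: codiff L (extd w).

Definition Delta0 (R : realType) (n : nat) (L : set 'rV[R]_n) (f : dform R n) :
    dform R n :=
  codiff L (extd f).

Definition has_dim (K : fieldType) (V : lmodType K) (E : set V) (m : nat) :
    Prop :=
  exists b : 'I_m -> V,
    (forall c : 'I_m -> K, \sum_i c i *: b i = 0 -> forall i, c i = 0) /\
    E = [set v | exists c : 'I_m -> K, v = \sum_i c i *: b i].

(* None stands for an infinite dimension. *)
Definition dimension (K : fieldType) (V : lmodType K) (E : set V) :
    option nat :=
  xget None [set d | exists2 m, has_dim E m & d = Some m].

Definition eigenspace_on (K : fieldType) (V : lmodType K) (E : set V)
    (T : V -> V) (lambda : K) : set V :=
  [set v | E v /\ T v = lambda *: v].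

Definition spectrum (K : fieldType) (V : lmodType K) (E : set V) (T : V -> V) :
    K -> option nat :=
  fun lambda => dimension (eigenspace_on E T lambda).

Definition F_spectrum (R : realType) (n : nat) (alpha beta : R) (p : nat)
    (L : set 'rV[R]_n) : R[i] -> option nat :=
  spectrum (Omega L p) (F_op alpha beta L).

(* Functions on R^n / L are its 0-forms. *)
Definition Delta0_spectrum (R : realType) (n : nat) (L : set 'rV[R]_n) :
    R[i] -> option nat :=
  spectrum (Omega L 0) (Delta0 L).

Definition isospectral (K : Type) (s1 s2 : K -> option nat) : Prop :=
  forall lambda : K, s1 lambda = s2 lambda.

(* Main.v *)
Require Import Defs.
From mathcomp Require Import all_boot all_order all_algebra.
From mathcomp Require Import complex finmap.
From mathcomp Require Import all_classical all_reals all_analysis.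
From mathcomp Require Import ring lra zify.

Set Implicit Arguments.
Unset Strict Implicit.
Unset Printing Implicit Defensive.

Import Order.TTheory GRing.Theory Num.Theory.
Import numFieldNormedType.Exports.

Local Open Scope ring_scope.

(** The operators have constant coefficients, so everything is read off the
    Fourier side.  Write B for a basis of the lattice and, for an integer vector
    k, let e_k = exp(2 pi i <k B^-T, x>) be the corresponding periodic character;
    its frequency vector is 2 pi k B^-T and lapl k is the squared length of that
    vector, i.e. the eigenvalue of the Laplacian on e_k.

    A smooth periodic form w is determined by the vectors of Fourier coefficients
    of its components (fcoef_inj), and integration by parts turns d and its
    adjoint into exterior multiplication and contraction with xi = i * frequency
    (fcoefs_extd, fcoefs_coform).  Hence w is an eigenform for lam iff at every k
    the coefficient vector of w is zero or a lam-eigenvector of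
       alpha * ext int + beta * int ext        (eigenform_fcoefs).
    By the Clifford relation ext int + int ext = lapl k and ext ext = 0, the
    operator ext int / lapl k is, for k <> 0, a projection; its complement is
    int ext / lapl k.  So the p-vectors at k split into an (alpha lapl k)-space
    and a (beta lapl k)-space, whose dimensions are traces of idempotents and
    come out as a = C(n-1, p-1) and b = C(n-1, p), independently of k
    (eigproj_trace).  At k = 0 everything is harmonic.

    With N(z) the number of k such that lapl k = z (mode_count), this gives
    multiplicity C(n, p) at lam = 0 and
       a N(lam / alpha) + b N(lam / beta)
    at lam <> 0 (has_dim_eigenspace, eigen_dimE); the Laplacian on functions is
    the case p = 0, alpha = beta = 1, with multiplicity N(lam) at lam <> 0.  So the
    spectrum on functions determines the spectrum on p-forms.  Conversely a > 0, and
    N vanishes near 0 except at 0 itself because the dual lattice is discrete; if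
    alpha < beta, the relation expresses N(z) through the multiplicities and
    N(z alpha / beta), and going down from z by the factor alpha / beta one
    reaches the region where N vanishes (scaling_unique).  The case alpha > beta is
    symmetric if b > 0 and immediate if b = 0.

    The analytic input is a mean over the torus, linear and translation invariant
    on continuous periodic functions, and positive on those that are nonnegative
    and not zero.  Invariance gives mean (D_v f) = 0 (mean_derive) and hence
    integration by parts; strict positivity gives uniqueness of the adjoint
    (codiffE) and, through a concentrating kernel, completeness of the characters
    (fourier_unique). *)

(** * Exterior multiplication and contraction *)

Section ExteriorAlgebra.
Context {K : numFieldType} {n : nat}.
Implicit Types (J A D : {set 'I_n}) (i j k : 'I_n) (v w : {set 'I_n} -> K) (xi : 'I_n -> K).

(** For j not in I, dx_j /\ dx_I is this sign times the dx of I with j added, where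
    J may be either of these two sets (wsignU1). *)
Definition wsign J j : K := (-1) ^+ #|[set i in J | (i < j)%N]|.

Lemma wsignM J j : wsign J j * wsign J j = 1.
Proof. by rewrite /wsign -exprMn mulrNN mul1r expr1n. Qed.

Lemma wsignU J k j : k \notin J -> wsign (k |: J) j = (-1) ^+ (k < j)%N * wsign J j.
Proof.
move=> kJ; rewrite /wsign -exprD; congr (_ ^+ _).
have [kj|kj] := boolP (k < j)%N.
  rewrite (_ : [set i in k |: J | (i < j)%N] = k |: [set i in J | (i < j)%N]).
    by rewrite cardsU1 inE (negPf kJ).
  by apply/setP => i; rewrite !inE; case: eqP => // ->; rewrite kj.
rewrite (_ : [set i in k |: J | (i < j)%N] = [set i in J | (i < j)%N])//.
by apply/setP => i; rewrite !inE; case: eqP => // ->; rewrite (negPf kj) !andbF.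
Qed.

Lemma wsignU1 J k : k \notin J -> wsign (k |: J) k = wsign J k.
Proof. by move=> /wsignU->; rewrite ltnn mul1r. Qed.

Lemma sign_swap j k : j != k ->
  (-1) ^+ (k < j)%N * (-1) ^+ (j < k)%N = - 1 :> K.
Proof.
move=> jk; case: (ltngtP k j) => [_|_|/val_inj kj].
- by rewrite expr1 expr0 mulr1.
- by rewrite expr1 expr0 mul1r.
- by rewrite kj eqxx in jk.
Qed.

(** A family v indexed by sets stands for the sum of the v_J dx_J; ext_mul is
    wedging with the covector xi on the left. *)
Definition ext_mul xi v J : K := \sum_(j in J) wsign J j * xi j * v (J :\ j).
(** Minus the contraction with xi: with xi standing for the partial derivatives,
    this is the formula of the codifferential. *)
Definition int_mul xi v J : K :=
  - \sum_(j | j \notin J) wsign (j |: J) j * xi j * v (j |: J).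

(** The double sum over ordered pairs changes sign when the pair is swapped. *)
Lemma ext_mul_ext_mul xi v J : ext_mul xi (ext_mul xi v) J = 0.
Proof.
pose u j k := wsign J j * xi j * (wsign (J :\ j) k * xi k * v (J :\ j :\ k)).
have -> : ext_mul xi (ext_mul xi v) J = \sum_(j in J) \sum_(k in J | k != j) u j k.
  apply: eq_bigr => j jJ; rewrite mulr_sumr; apply: eq_big => k //.
  by rewrite !inE andbC.
set T := LHS; suff : T = - T.
  by move/eqP; rewrite -addr_eq0 -mulr2n mulrn_eq0 => /eqP.
rewrite {1}/T (exchange_big_dep (mem J))/=; last by move=> j k _ /andP[].
rewrite /T -sumrN; apply: eq_bigr => k kJ; rewrite -sumrN.
apply: eq_big => j.
  by rewrite kJ/= eq_sym.
move=> /andP[jJ]; rewrite kJ/= => kj.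
have H a c : a \in J -> c \in J -> c != a ->
    wsign (J :\ a) c = (-1) ^+ (a < c)%N * wsign J c.
  move=> aJ cJ ca; rewrite -{2}(finset.setD1K aJ) wsignU ?finset.setD11//.
  by rewrite mulrA -exprMn mulrNN mul1r expr1n mul1r.
rewrite /u (H j k)// (H k j)//; last by rewrite eq_sym.
have jk : j != k by rewrite eq_sym.
have -> : J :\ k :\ j = J :\ j :\ k.
  by apply/setP => i; rewrite !inE andbCA.
have -> : (-1) ^+ (j < k)%N = - (-1) ^+ (k < j)%N :> K.
  have /(congr1 (fun x => (-1) ^+ (k < j)%N * x)) := sign_swap jk.
  by rewrite mulrA -exprMn mulrNN mul1r expr1n mul1r mulrN1.
by ring.
Qed.

(** The diagonal terms of both compositions give the sum of squares, each index j
    occurring in exactly one of them according to whether it lies in J; the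
    off-diagonal terms replace j in J by k outside J and cancel, since exactly one
    of k < j and j < k holds. *)
Lemma clifford xi v J :
  ext_mul xi (int_mul xi v) J + int_mul xi (ext_mul xi v) J = - (\sum_j xi j ^+ 2) * v J.
Proof.
pose u j k := wsign J j * xi j * (wsign (k |: (J :\ j)) k * xi k * v (k |: (J :\ j))).
pose u' j k := wsign (k |: J) k * xi k * (wsign (k |: J) j * xi j * v ((k |: J) :\ j)).
have -> : ext_mul xi (int_mul xi v) J =
    - (\sum_(j in J) xi j ^+ 2) * v J - \sum_(j in J) \sum_(k | k \notin J) u j k.
  rewrite mulNr mulr_suml -opprD -big_split/= -sumrN.
  apply: eq_bigr => j jJ; rewrite mulrN; congr (- _).
  rewrite (bigD1 j)/= ?finset.setD11// mulrDr; congr (_ + _).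
    rewrite finset.setD1K// -[in RHS](mul1r (xi j ^+ 2)) -(wsignM J j); ring.
  rewrite mulr_sumr; apply: eq_bigl => k; rewrite !inE negb_and negbK.
  by case: eqP => [->|_]; rewrite ?jJ ?andbF ?andbT.
have -> : int_mul xi (ext_mul xi v) J =
    - (\sum_(j | j \notin J) xi j ^+ 2) * v J - \sum_(k | k \notin J) \sum_(j in J) u' j k.
  rewrite mulNr mulr_suml -opprD -big_split/=; congr (- _).
  apply: eq_bigr => k kJ.
  rewrite /ext_mul (bigD1 k)/= ?finset.setU11// mulrDr; congr (_ + _).
    rewrite finset.setU1K// -[in RHS](mul1r (xi k ^+ 2)) -(wsignM (k |: J) k); ring.
  rewrite mulr_sumr; apply: eq_bigl => j; rewrite !inE.
  by case: eqP => [->|_]; rewrite ?andbT ?andbF// (negPf kJ).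
rewrite [\sum_(k | _) \sum_(j in J) _]exchange_big/=.
have -> : \sum_(j in J) \sum_(k | k \notin J) u' j k = - \sum_(j in J) \sum_(k | k \notin J) u j k.
  rewrite -sumrN; apply: eq_bigr => j jJ; rewrite -sumrN; apply: eq_bigr => k kJ.
  have jk : j != k by apply: contraNneq kJ => <-.
  rewrite /u /u'.
  have -> : (k |: J) :\ j = k |: (J :\ j).
    apply/setP => i; rewrite !inE; case: (eqVneq i k) => [->|]//=.
    by rewrite eq_sym jk.
  have kD : k \notin J :\ j by rewrite !inE (negPf kJ) andbF.
  have jD : j \notin J :\ j by rewrite finset.setD11.
  rewrite (wsignU1 kD) (wsignU1 kJ) (wsignU j kJ) -(finset.setD1K jJ).
  rewrite !(wsignU _ jD) ltnn mul1r finset.setU1K//.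
  have := sign_swap jk; set s1 := _ ^+ _; set s2 := _ ^+ _; set p := wsign _ _; set q := wsign _ _.
  by move=> E; rewrite [LHS](_ : _ = (s1 * s2) * (p * xi k * (q * xi j * v (k |: J :\ j)))); [rewrite E; ring|ring].
rewrite [X in _ = - X * _](bigID (mem J))/=.
by ring.
Qed.

End ExteriorAlgebra.

(** * Eigenspaces of the symbol *)
Section LinearOperators.
Context {K : numFieldType} {I : finType}.
Implicit Types (v w : I -> K) (Z : (I -> K) -> (I -> K)).

Definition linop Z := forall a v w i, Z (fun x => a * v x + w x) i = a * Z v i + Z w i.
(** Together with linop_ind, the values Z (ind j) i are the matrix of Z. *)
Definition ind (i : I) : I -> K := fun j => (j == i)%:R.

Lemma linop0 Z i : linop Z -> Z (fun=> 0) i = 0.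
Proof.
move=> lZ; have := lZ (-1) (fun=> 0) (fun=> 0) i.
rewrite (_ : (fun _ => -1 * 0 + 0) = (fun=> 0 : K)); last by apply/funext => x; rewrite mulr0 addr0.
by rewrite mulN1r addNr.
Qed.

Lemma linop_ind Z v i : linop Z -> \sum_j v j * Z (ind j) i = Z v i.
Proof.
move=> lZ; have H (r : seq I) : Z (fun x => \sum_(j <- r) v j * ind j x) i = \sum_(j <- r) v j * Z (ind j) i.
  elim: r => [|j r IH].
    by under eq_fun do rewrite big_nil; rewrite big_nil linop0.
  under eq_fun do rewrite big_cons; rewrite big_cons -IH.
  exact: (lZ (v j) (ind j) (fun x => \sum_(l <- r) v l * ind l x) i).
rewrite -H; congr (Z _ i); apply/funext => x.
rewrite (bigD1 x)//= /ind eqxx mulr1 big1 ?addr0// => j jx.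
by rewrite eq_sym (negPf jx) mulr0.
Qed.

End LinearOperators.

(** The numbers of p-subsets of a set of n elements that do, resp. do not, contain
    a given element: C(n-1, p-1) and C(n-1, p) for n, p > 0.  Defining the first
    as a difference covers p = 0 as well. *)
Definition exact_mult (n p : nat) : nat := 'C(n, p) - 'C(n.-1, p).
Definition coexact_mult (n p : nat) : nat := 'C(n.-1, p).

Section EigenProjection.
Context {K : numFieldType} {n : nat} (xi : 'I_n -> K) (p : nat).
Implicit Types (J A D : {set 'I_n}) (i j k : 'I_n) (v w : {set 'I_n} -> K).

(** The squared length of the frequency when xi is i times a real frequency. *)
Definition mu : K := - \sum_j xi j ^+ 2.

Definition pdeg q v J : K := if #|J| == q then v J else 0.

Lemma ext_mul_lin : linop (ext_mul xi).
Proof.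
move=> a v w J; rewrite /ext_mul mulr_sumr -big_split/=; apply: eq_bigr => j _.
by ring.
Qed.

Lemma int_mul_lin : linop (int_mul xi).
Proof.
move=> a v w J; rewrite /int_mul mulrN -opprD mulr_sumr -big_split/=; congr (- _).
by apply: eq_bigr => j _; ring.
Qed.

Lemma pdeg_lin q : linop (pdeg q).
Proof. by move=> a v w J; rewrite /pdeg; case: (_ == q) => //; rewrite mulr0 addr0. Qed.

Lemma ext_mul_pdeg q v J : ext_mul xi (pdeg q v) J = pdeg q.+1 (ext_mul xi v) J.
Proof.
rewrite /pdeg /ext_mul; case: ifPn => [Jq|Jq]; last rewrite big1//; last first.
  move=> j jJ; case: ifP; rewrite ?mulr0// => /eqP Jjq.
  by rewrite (cardsD1 j) jJ Jjq eqxx in Jq.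
apply: eq_bigr => j jJ; rewrite ifT//.
by move: Jq; rewrite (cardsD1 j) jJ eqSS.
Qed.

Lemma int_mul_pdeg q v J : int_mul xi (pdeg q.+1 v) J = pdeg q (int_mul xi v) J.
Proof.
rewrite /pdeg /int_mul; case: ifPn => [Jq|Jq]; last rewrite big1 ?oppr0//; last first.
  by move=> j jJ; rewrite cardsU1 jJ eqSS (negPf Jq) mulr0.
by congr (- _); apply: eq_bigr => j jJ; rewrite cardsU1 jJ eqSS Jq.
Qed.

Lemma int_mul_pdeg0 v J : int_mul xi (pdeg 0 v) J = 0.
Proof.
rewrite /int_mul /pdeg big1 ?oppr0// => j jJ.
by rewrite cardsU1 jJ/= mulr0.
Qed.

Lemma pdeg0_ext_mul v J : pdeg 0 (ext_mul xi v) J = 0.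
Proof.
rewrite /pdeg; case: ifP => //; rewrite cards_eq0 => /eqP->.
by rewrite /ext_mul big1// => j; rewrite inE.
Qed.

(** For mu <> 0, the projection onto the image of ext_mul along the image of
    int_mul. *)
Definition exact_part v J : K := mu^-1 * ext_mul xi (int_mul xi v) J.

Lemma exact_part_lin : linop exact_part.
Proof.
move=> a v w J; rewrite /exact_part.
rewrite (_ : int_mul xi _ = fun J => a * int_mul xi v J + int_mul xi w J); last first.
  by apply/funext => A; rewrite int_mul_lin.
by rewrite ext_mul_lin; ring.
Qed.

Lemma exact_part_pdeg v J : exact_part (pdeg p v) J = pdeg p (exact_part v) J.
Proof.
rewrite /exact_part; case: p => [|q].
  rewrite (_ : int_mul xi _ = fun=> 0); last by apply/funext => A; exact: int_mul_pdeg0.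
  rewrite linop0; last exact: ext_mul_lin.
  rewrite mulr0; have := pdeg0_ext_mul (int_mul xi v) J; rewrite /pdeg.
  by case: (_ == 0)%N => // ->; rewrite mulr0.
rewrite (_ : int_mul xi _ = pdeg q (int_mul xi v)); last by apply/funext => A; exact: int_mul_pdeg.
by rewrite ext_mul_pdeg /pdeg; case: ifP => // _; rewrite mulr0.
Qed.

Lemma ext_mul_int_mul v J :
  ext_mul xi (int_mul xi v) J + int_mul xi (ext_mul xi v) J = mu * v J.
Proof. by rewrite clifford. Qed.

(** ext_mul kills w = exact_part v, so the Clifford relation reads
    ext_mul (int_mul w) = mu * w. *)
Lemma exact_part_idem v J : mu != 0 -> exact_part (exact_part v) J = exact_part v J.
Proof.
move=> mu0; rewrite {1}/exact_part; set w := exact_part v.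
have ww A : ext_mul xi w A = 0.
  rewrite /w /exact_part.
  have := ext_mul_lin mu^-1 (ext_mul xi (int_mul xi v)) (fun=> 0) A.
  rewrite ext_mul_ext_mul mulr0 linop0; last exact: ext_mul_lin.
  by under eq_fun do rewrite addr0; rewrite addr0.
have := ext_mul_int_mul w J.
rewrite (_ : ext_mul xi w = fun=> 0); last by apply/funext => A; exact: ww.
rewrite linop0; last exact: int_mul_lin.
by rewrite addr0 => ->; rewrite mulKf.
Qed.

Context (al be lam : K).

(** The symbol of alpha d delta + beta delta d. *)
Definition fsymbol v J : K :=
  al * ext_mul xi (int_mul xi v) J + be * int_mul xi (ext_mul xi v) J.

(** The projection onto the lam-eigenspace of fsymbol in degree p.  The case mu = 0
    is meant for xi = 0, where fsymbol is zero and exact_part says nothing. *)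
Definition eigproj v J : K :=
  if mu == 0 then (lam == 0)%:R * pdeg p v J
  else (al * mu == lam)%:R * exact_part (pdeg p v) J +
       (be * mu == lam)%:R * (pdeg p v J - exact_part (pdeg p v) J).

Lemma eigproj_lin : linop eigproj.
Proof.
move=> a v w J; rewrite /eigproj pdeg_lin; case: ifP => _; first ring.
rewrite (_ : pdeg p _ = fun J => a * pdeg p v J + pdeg p w J); last first.
  by apply/funext => A; rewrite pdeg_lin.
by rewrite exact_part_lin; ring.
Qed.

Lemma eigproj_pdeg v J : pdeg p (eigproj v) J = eigproj v J.
Proof.
rewrite {1}/pdeg; case: ifPn => // Jp.
by rewrite /eigproj !exact_part_pdeg /pdeg (negPf Jp) subrr !mulr0 addr0 if_same.
Qed.

Lemma eigproj_idem v J : eigproj (eigproj v) J = eigproj v J.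
Proof.
have pE : pdeg p (eigproj v) = eigproj v by apply/funext => A; exact: eigproj_pdeg.
rewrite {1}/eigproj pE; case: ifPn => [m0|m0].
  by rewrite /eigproj m0 mulrA -natrM mulnb andbb.
have eE A : exact_part (eigproj v) A = (al * mu == lam)%:R * exact_part (pdeg p v) A.
  rewrite [eigproj v](_ : _ = fun J => ((al * mu == lam)%:R - (be * mu == lam)%:R) * exact_part (pdeg p v) J +
     ((be * mu == lam)%:R * pdeg p v J + 0)).
    rewrite exact_part_lin exact_part_lin exact_part_idem// linop0; last exact: exact_part_lin.
    by ring.
  by apply/funext => J'; rewrite /eigproj (negPf m0); ring.
rewrite eE /eigproj (negPf m0).
have bb (e : bool) : e%:R * e%:R = e%:R :> K by rewrite -natrM mulnb andbb.
set e1 := (al * mu == lam)%:R; set e2 := (be * mu == lam)%:R.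
rewrite [LHS](_ : _ = (e1 * e1) * exact_part (pdeg p v) J +
    (e2 * e2) * (pdeg p v J - exact_part (pdeg p v) J)); last by ring.
by rewrite !bb.
Qed.

(** For mu <> 0, exact_part and its complement are projections onto subspaces where
    fsymbol is multiplication by al * mu and by be * mu. *)
Lemma eigprojP v : (mu = 0 -> forall j, xi j = 0) ->
  (forall J, eigproj v J = v J) <->
  (forall J, #|J| != p -> v J = 0) /\ (forall J, fsymbol v J = lam * v J).
Proof.
move=> xi0; split.
  move=> ev; have pv : pdeg p v = v.
    by apply/funext => J; rewrite -[in RHS]ev -eigproj_pdeg; congr (pdeg p _ J); apply/funext.
  split; first by move=> J Jp; rewrite -pv /pdeg (negPf Jp).
  move=> J; rewrite /fsymbol.
  have := ev J; rewrite /eigproj pv; case: ifPn => [/eqP m0 E|m0 E].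
    have x0 := xi0 m0.
    rewrite [ext_mul _ _ _](_ : _ = 0); last by rewrite /ext_mul big1// => j _; rewrite x0 mulr0 mul0r.
    rewrite [int_mul _ _ _](_ : _ = 0); last by rewrite /int_mul big1 ?oppr0// => j _; rewrite x0 mulr0 mul0r.
    move: E; rewrite !mulr0 addr0; case: eqP => [->|_]; first by rewrite mul0r.
    by rewrite mul0r => <-; rewrite mulr0.
  have w1 : ext_mul xi (int_mul xi v) J = mu * exact_part v J by rewrite /exact_part mulVKf.
  have w2 : int_mul xi (ext_mul xi v) J = mu * (v J - exact_part v J).
    by rewrite mulrBr -w1 -ext_mul_int_mul addrC addKr.
  rewrite w1 w2 (mulrA al mu) (mulrA be mu); set P := exact_part v J in E *.
  have [am|am] := eqVneq (al * mu) lam; have [bm|bm] := eqVneq (be * mu) lam.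
  - by rewrite am bm; ring.
  - move: E; rewrite am (negPf bm) eqxx mul1r mul0r addr0 => ->.
    by rewrite subrr mulr0 addr0.
  - move: E; rewrite bm (negPf am) eqxx mul1r mul0r add0r => E.
    have -> : P = 0 by rewrite -(subKr (v J) P) E subrr.
    by rewrite mulr0 add0r subr0.
  - have v0 : v = fun=> 0.
      apply/funext => A; rewrite -ev /eigproj (negPf m0) (negPf am) (negPf bm).
      by rewrite !mul0r addr0.
    by rewrite /P v0 linop0 ?subrr ?mulr0 ?addr0//; exact: exact_part_lin.
move=> [vp Fv] J.
have pv : pdeg p v = v.
  by apply/funext => A; rewrite /pdeg; case: ifPn => // /vp ->.
have := Fv J; rewrite /fsymbol /eigproj pv; case: ifPn => [/eqP m0|m0].
  have x0 := xi0 m0.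
  rewrite [ext_mul _ _ _](_ : _ = 0); last by rewrite /ext_mul big1// => j _; rewrite x0 mulr0 mul0r.
  rewrite [int_mul _ _ _](_ : _ = 0); last by rewrite /int_mul big1 ?oppr0// => j _; rewrite x0 mulr0 mul0r.
  rewrite !mulr0 addr0; case: eqP => [_ _|/eqP l0 /esym/eqP]; first by rewrite mul1r.
  by rewrite mulf_eq0 (negPf l0)/= => /eqP->; rewrite mulr0.
move=> _.
have FvE A : al * mu * exact_part v A + be * mu * (v A - exact_part v A) = lam * v A.
  have w1 : ext_mul xi (int_mul xi v) A = mu * exact_part v A by rewrite /exact_part mulVKf.
  have w2 : int_mul xi (ext_mul xi v) A = mu * (v A - exact_part v A).
    by rewrite mulrBr -w1 -ext_mul_int_mul addrC addKr.
  by have := Fv A; rewrite /fsymbol w1 w2 (mulrA al mu) (mulrA be mu).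
(* apply exact_part to the eigenvalue equation *)
have XE : (al * mu - lam) * exact_part v J = 0.
  have E1 : exact_part (fun A => lam * v A + 0) J = lam * exact_part v J.
    by rewrite exact_part_lin (linop0 _ exact_part_lin) addr0.
  have E2 : exact_part (fun A => (al * mu - be * mu) * exact_part v A + (be * mu * v A + 0)) J =
      (al * mu - be * mu) * exact_part v J + be * mu * exact_part v J.
    by rewrite !exact_part_lin (linop0 _ exact_part_lin) addr0 exact_part_idem.
  rewrite mulrBl -E1; apply/eqP; rewrite subr_eq0; apply/eqP.
  transitivity ((al * mu - be * mu) * exact_part v J + be * mu * exact_part v J); first by ring.
  rewrite -E2; congr (exact_part _ J); apply/funext => A.
  by rewrite !addr0 -FvE; ring.
have YE : (be * mu - lam) * (v J - exact_part v J) = 0.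
  rewrite (_ : _ * _ = al * mu * exact_part v J + be * mu * (v J - exact_part v J) - lam * v J - (al * mu - lam) * exact_part v J); last by ring.
  by rewrite XE FvE subrr subr0.
have e1 : (al * mu == lam)%:R * exact_part v J = exact_part v J.
  move/eqP: XE; rewrite mulf_eq0 subr_eq0 => /orP[->|/eqP->]; first by rewrite mul1r.
  by rewrite mulr0.
have e2 : (be * mu == lam)%:R * (v J - exact_part v J) = v J - exact_part v J.
  move/eqP: YE; rewrite mulf_eq0 subr_eq0 => /orP[->|/eqP->]; first by rewrite mul1r.
  by rewrite mulr0.
by rewrite e1 e2 addrC subrK.
Qed.

Lemma card_degree : \sum_J pdeg p (@ind K _ J) J = 'C(n, p)%:R.
Proof.
rewrite -[n in 'C(n, _)](card_ord n) -card_draws -sum1_card natr_sum [RHS]big_mkcond/=.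
by apply: eq_bigr => J _; rewrite /pdeg /ind eqxx inE.
Qed.

Lemma card_degree_containing j : #|[set J : {set 'I_n} | (#|J| == p) && (j \in J)]| = exact_mult n p.
Proof.
rewrite /exact_mult -[n in 'C(n, _)](card_ord n) -card_draws.
have -> : 'C(n.-1, p) = #|[set J : {set 'I_n} | J \subset [set~ j] & #|J| == p]|.
  by rewrite cards_draws cardsC1 card_ord.
rewrite -(cardsID [set J : {set 'I_n} | j \in J] [set J : {set 'I_n} | #|J| == p]).
rewrite (_ : _ :\: _ = [set J : {set 'I_n} | J \subset [set~ j] & #|J| == p]).
  by rewrite addnK; apply: eq_card => J; rewrite !inE.
apply/setP => J; rewrite !inE; congr (_ && _). apply/idP/fintype.subsetP => [jJ k kJ|H].
  by rewrite !inE; apply: contraNneq jJ => <-.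
by apply/negP => /H; rewrite !inE eqxx.
Qed.

Lemma ext_int_diag J : ext_mul xi (int_mul xi (ind J)) J = \sum_(j in J) - xi j ^+ 2.
Proof.
apply: eq_bigr => j jJ; rewrite /int_mul (bigD1 j) ?finset.setD11//= big1; last first.
  move=> k /andP[kJ kj]; rewrite /ind (_ : (_ == J) = false) ?mulr0//.
  apply/negP => /eqP/setP/(_ j); rewrite !inE eqxx jJ/= orbF eq_sym.
  by rewrite (negPf kj).
rewrite addr0 finset.setD1K// /ind eqxx mulr1 mulrN.
by rewrite -[in RHS](mul1r (xi j ^+ 2)) -(wsignM J j); ring.
Qed.

(** The diagonal entry at J is the sum of - xi_j^2 / mu over j in J; each j lies in
    exact_mult n p of the sets J of size p, and the total weight is 1. *)
Lemma exact_part_trace : mu != 0 ->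
  \sum_J exact_part (pdeg p (@ind K _ J)) J = (exact_mult n p)%:R.
Proof.
move=> m0.
have E J : exact_part (pdeg p (@ind K _ J)) J = \sum_j ((#|J| == p) && (j \in J))%:R * (mu^-1 * - xi j ^+ 2).
  rewrite exact_part_pdeg /pdeg; case: eqP => _; last by rewrite big1// => j _; rewrite mul0r.
  rewrite /exact_part ext_int_diag mulr_sumr big_mkcond/=; apply: eq_bigr => j _.
  by case: (j \in J); rewrite ?mul1r ?mul0r.
rewrite (eq_bigr _ (fun J _ => E J)) exchange_big/=.
transitivity (\sum_j (exact_mult n p)%:R * (mu^-1 * - xi j ^+ 2)).
  apply: eq_bigr => j _; rewrite -mulr_suml; congr (_ * _).
  rewrite -(card_degree_containing j) -sum1_card natr_sum [RHS]big_mkcond/=.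
  by apply: eq_bigr => J _; rewrite inE; case: (_ && _).
by rewrite -!mulr_sumr sumrN -/mu mulVf// mulr1.
Qed.

Lemma eigproj_trace : \sum_J eigproj (@ind K _ J) J =
  (if mu == 0 then ((lam == 0)%R * 'C(n, p))%N
   else ((al * mu == lam)%R * exact_mult n p + (be * mu == lam)%R * coexact_mult n p)%N)%:R.
Proof.
rewrite /eigproj; case: ifPn => m0; first by rewrite -mulr_sumr card_degree natrM.
rewrite big_split/= -mulr_sumr -[X in _ + X]mulr_sumr big_split/= sumrN.
rewrite exact_part_trace// card_degree.
rewrite natrD !natrM; congr (_ + _ * _).
rewrite -natrB; last by rewrite /exact_mult leq_subr.
congr (_%:R); rewrite /exact_mult /coexact_mult subKn//.
by apply: leq_bin2l; exact: leq_pred.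
Qed.

End EigenProjection.

(** The combinatorial core of the adjunction between d and delta. *)
Section Reindex.
Context {V : nmodType} {n : nat}.

Lemma sum_delete_insert (G : {set 'I_n} -> 'I_n -> V) :
  \sum_(J : {set 'I_n}) \sum_(j in J) G J j = \sum_(I : {set 'I_n}) \sum_(j | j \notin I) G (j |: I) j.
Proof.
rewrite (exchange_big_dep predT)//= [RHS](exchange_big_dep predT)//=.
apply: eq_bigr => j _.
rewrite (reindex_onto (fun I : {set 'I_n} => j |: I) (fun J => J :\ j))/=; last first.
  by move=> J jJ; rewrite finset.setD1K.
apply: eq_bigl => I; rewrite finset.setU11/=.
apply/eqP/idP => [<-|jI]; first by rewrite finset.setD11.
exact: finset.setU1K.
Qed.

End Reindex.

Local Open Scope classical_set_scope.
Local Open Scope complex_scope.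
Local Open Scope ring_scope.

(** * Dimension of the fixed space of an idempotent *)
Section DimensionTheory.
Context {K : fieldType} {V : lmodType K}.

Lemma has_dim_le (E : set V) m m' : has_dim E m -> has_dim E m' -> (m <= m')%N.
Proof.
move=> [b [bfree EE]] [b' [_ EE']].
have coord i : exists c : 'I_m' -> K, b i = \sum_j c j *: b' j.
  have : E (b i).
    rewrite EE; exists (fun j => (j == i)%:R); rewrite (bigD1 i)//= eqxx scale1r big1 ?addr0// => j ji.
    by rewrite (negPf ji) scale0r.
  by rewrite EE'.
have /choice[c cE] := coord.
pose M : 'M[K]_(m, m') := \matrix_(i, j) c i j.
suff /eqP <- : row_free M by exact: rank_leq_col.
apply/inj_row_free => u uM0.
apply/rowP => i; rewrite mxE; apply: (bfree (fun i => u ord0 i)).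
under eq_bigr do rewrite cE scaler_sumr.
rewrite exchange_big/= big1// => j _.
under eq_bigr do rewrite scalerA.
have /rowP/(_ j) := uM0; rewrite !mxE -scaler_suml => M0.
rewrite (_ : \sum_i _ = 0) ?scale0r// -[RHS]M0.
by apply: eq_bigr => l _; rewrite mxE.
Qed.

Lemma dimensionE (E : set V) m : has_dim E m -> dimension E = Some m.
Proof.
move=> Em; rewrite /dimension.
have /(xgetPex None)[m' Em' ->] : exists d, [set d | exists2 m, has_dim E m & d = Some m] d.
  by exists (Some m), m.
by congr Some; apply/eqP; rewrite eqn_leq (has_dim_le Em' Em) (has_dim_le Em Em').
Qed.

End DimensionTheory.

Section Idempotent.
Context {K : numFieldType} {V : lmodType K} {I : finType} (b : I -> V).

(** Factor M = C R through its rank; cancelling C and R in C R C R = C R gives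
    R C = 1, and tr (C R) = tr (R C). *)
Lemma mxtrace_idempotent m (M : 'M[K]_m) : M *m M = M -> \tr M = (\rank M)%:R.
Proof.
move=> MM.
have E := mulmx_base M.
have RC : row_base M *m col_base M = 1%:M.
  have : col_base M *m (row_base M *m col_base M) *m row_base M = col_base M *m row_base M.
    by rewrite mulmxA E -mulmxA E MM.
  move=> /(row_free_inj (row_base_free M)) /= /(congr1 (mulmx (pinvmx (col_base M)))).
  by rewrite mulmxA mulVpmx ?col_base_full// mul1mx.
by rewrite -[in LHS]E mxtrace_mulC RC mxtrace1.
Qed.

(** Dimensions are computed by traces: no basis of the fixed space has to be
    exhibited. *)
Lemma has_dim_idempotent (z : I -> I -> K) (d : nat) :
  (forall c : I -> K, \sum_i c i *: b i = 0 -> forall i, c i = 0) ->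
  (forall i k, \sum_j z i j * z j k = z i k) ->
  \sum_i z i i = d%:R ->
  has_dim [set v | exists c : I -> K, (forall i, \sum_j c j * z j i = c i) /\
                                      v = \sum_i c i *: b i] d.
Proof.
move=> bfree zz tr.
pose M : 'M[K]_#|I| := \matrix_(i, j) z (enum_val i) (enum_val j).
have sumE (F : I -> K) : \sum_(i < #|I|) F (enum_val i) = \sum_i F i.
  by rewrite [RHS](reindex (@enum_val I predT))//=; exact/onW_bij/enum_val_bij.
have MM : M *m M = M.
  apply/matrixP => i k; rewrite !mxE -zz -sumE.
  by apply: eq_bigr => j _; rewrite !mxE.
have rE : d = \rank M.
  apply/eqP; rewrite -(eqr_nat K) -mxtrace_idempotent// -tr -sumE /mxtrace.
  by apply/eqP/eq_bigr => i _; rewrite mxE.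
rewrite {}rE.
pose comb (u : 'rV[K]_#|I|) : V := \sum_i u ord0 (enum_rank i) *: b i.
have combE m (A : 'M[K]_(m, #|I|)) (c : 'I_m -> K) :
    \sum_i c i *: comb (row i A) = comb ((\row_i c i) *m A).
  under eq_bigr do rewrite /comb scaler_sumr.
  rewrite exchange_big/=; apply: eq_bigr => i _.
  under eq_bigr do rewrite scalerA.
  rewrite -scaler_suml; congr (_ *: _); rewrite mxE; apply: eq_bigr => l _.
  by rewrite !mxE.
exists (fun i => comb (row i (row_base M))); split.
  move=> c; rewrite combE => /bfree c0.
  have : (\row_i c i) *m row_base M = 0.
    by apply/rowP => l; rewrite -[l]enum_valK c0 mxE.
  move=> /(congr1 (mulmxr (pinvmx (row_base M)))) /=.
  rewrite mul0mx -mulmxA mulmxVp ?row_base_free// mulmx1 => /rowP c1 i.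
  by have := c1 i; rewrite !mxE.
apply/seteqP; split => v [c].
  move=> [zc ->]; pose u : 'rV[K]_#|I| := \row_i c (enum_val i).
  have uM : u *m M = u.
    apply/rowP => i; rewrite !mxE -zc -sumE; apply: eq_bigr => j _.
    by rewrite !mxE.
  have : (u <= row_base M)%MS by rewrite eq_row_base -uM submxMl.
  move=> /submxP[D uD]; exists (fun i => D ord0 i).
  rewrite combE (_ : \row_i D ord0 i = D); last by apply/rowP => i; rewrite mxE.
  by rewrite -uD; apply: eq_bigr => i _; rewrite mxE enum_rankK.
move=> ->; set u := (\row_i c i) *m row_base M.
exists (fun i => u ord0 (enum_rank i)); split; last by rewrite combE.
have uM : u *m M = u.
  have /submxP[D uD] : (u <= M)%MS by rewrite -(eq_row_base M) submxMl.
  by rewrite uD -mulmxA MM.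
move=> i; rewrite -[in RHS]uM mxE -sumE; apply: eq_bigr => j _.
by rewrite [M _ _]mxE enum_valK enum_rankK.
Qed.

End Idempotent.

(** * The integral over the unit interval *)
Section UnitIntegral.
Context {R : realType}.
Implicit Types (f g F : R -> R) (x y z a b c d : R).

Definition unit_integral f : R :=
  Rintegral lebesgue_measure `[0%R, 1%R] f.

Lemma continuous_itg f a b : continuous f ->
  (@lebesgue_measure R).-integrable `[a, b] (EFin \o f).
Proof.
move=> cf; apply: continuous_compact_integrable; first exact: segment_compact.
exact: continuous_subspaceT.
Qed.

Lemma unit_integralD f g : continuous f -> continuous g ->
  unit_integral (fun x => f x + g x) = unit_integral f + unit_integral g.
Proof. by move=> cf cg; rewrite /unit_integral RintegralD//; exact: continuous_itg. Qed.

Lemma unit_integralZ (a : R) f : continuous f ->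
  unit_integral (fun x => a * f x) = a * unit_integral f.
Proof. by move=> cf; rewrite /unit_integral RintegralZl//; exact: continuous_itg. Qed.

Lemma unit_integral_cst (a : R) : unit_integral (fun=> a) = a.
Proof.
rewrite /unit_integral Rintegral_cst//=.
rewrite (lebesgue_measure_itv `[0, 1]%R)/= lte_fin ltr01.
by rewrite -EFinB subr0 mulr1.
Qed.

Lemma le_unit_integral f g : continuous f -> continuous g ->
  (forall x, 0 <= x <= 1 -> f x <= g x) -> unit_integral f <= unit_integral g.
Proof.
move=> cf cg fg; apply: le_Rintegral; [exact: measurable_itv|exact: continuous_itg cf|exact: continuous_itg cg|].
by move=> x /=; rewrite in_itv/=; exact: fg.
Qed.

Lemma eq_unit_integral f g : (forall x, 0 <= x <= 1 -> f x = g x) ->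
  unit_integral f = unit_integral g.
Proof.
by move=> fg; apply: eq_Rintegral => x; rewrite inE/= in_itv/=; exact: fg.
Qed.

(** The lower bound c lets one antiderivative serve at all points of interest,
    including the endpoints of the interval of integration. *)
Lemma ex_antiderivative f (c : R) : continuous f ->
  exists F : R -> R, forall x, c < x -> is_derive x (1 : R) F (f x).
Proof.
move=> cf; exists (fun x => Rintegral lebesgue_measure `[c, x] f) => x cx.
have := @continuous_FTC1_closed R f c x (x + 1) _ _ cx (cf x).
case; [by rewrite ltrDl|exact: continuous_itg|move=> d e].
by apply: DeriveDef; [exact: d|rewrite -derive1E; exact: e].
Qed.

Lemma is_derive_continuous f F (x : R) : is_derive x (1 : R) F (f x) ->
  {for x, continuous F}.
Proof.
by case=> d _; apply: differentiable_continuous; exact/derivable1_diffP.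
Qed.

Lemma MVT_closed f F (a b : R) : a <= b ->
  (forall x : R, a <= x <= b -> is_derive x (1 : R) F (f x)) ->
  exists2 c, a <= c <= b & F b - F a = f c * (b - a).
Proof.
move=> ab dF.
have [||c] := @MVT_segment R F f a b ab.
- move=> x; rewrite in_itv/= => /andP[/ltW ax /ltW xb]; apply: dF.
  by rewrite ax.
- apply: continuous_in_subspaceT => x; rewrite inE/= in_itv/= => /dF.
  exact: is_derive_continuous.
- by rewrite in_itv/=; exists c.
Qed.

Lemma unit_integral_FTC f F : continuous f ->
  (forall x : R, 0 <= x <= 1 -> is_derive x (1 : R) F (f x)) ->
  unit_integral f = F 1 - F 0.
Proof.
move=> cf dF; rewrite /unit_integral /Rintegral (@continuous_FTC2 R f F)//.
- exact: continuous_subspaceT.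
- split.
  + move=> x; rewrite in_itv/= => /andP[/ltW x0 /ltW x1].
    by have [] := dF x; rewrite ?x0.
  + apply: cvg_at_right_filter; apply: is_derive_continuous (dF _ _).
    by rewrite lexx ler01.
  + apply: cvg_at_left_filter; apply: is_derive_continuous (dF _ _).
    by rewrite lexx ler01.
- move=> x; rewrite in_itv/= => /andP[/ltW x0 /ltW x1].
  by have [|_] := dF x; rewrite ?x0// derive1E.
Qed.

(** By the mean value theorem an antiderivative is nondecreasing on [0, 1], and
    strictly increasing on an interval where f > 0. *)
Lemma unit_integral_gt0 f (x0 : R) : continuous f ->
  (forall x, 0 <= x <= 1 -> 0 <= f x) -> 0 <= x0 <= 1 -> 0 < f x0 ->
  0 < unit_integral f.
Proof.
move=> cf f0 /andP[x00 x01] fx0.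
have [F dF] := ex_antiderivative (-1) cf.
have dF01 x : 0 <= x -> is_derive x (1 : R) F (f x).
  by move=> x0'; apply: dF; rewrite (lt_le_trans _ x0')// ltrN10.
have -> : unit_integral f = F 1 - F 0.
  by apply: unit_integral_FTC => // x /andP[/dF01].
have [d d0 fd] : exists2 d, 0 < d & forall x, `|x0 - x| < d -> 0 < f x.
  have : \forall x \near x0, 0 < f x by exact: (cvgr_gt (f x0) (cf x0)).
  by move=> /nbhs_ballP[d /= d0 fd]; exists d.
have [a [b [a0 ab b1 fab]]] : exists a b,
    [/\ 0 <= a, a < b, b <= 1 & forall x, a <= x <= b -> 0 < f x].
  have [x1|x1] := ltP x0 1.
    exists x0, (Num.min 1 (x0 + d / 2)); split => //.
    - by rewrite lt_min x1/= ltrDl divr_gt0.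
    - by rewrite ge_min lexx.
    move=> x /andP[x0x]; rewrite le_min => /andP[_ xd]; apply: fd.
    rewrite distrC ger0_norm ?subr_ge0//.
    by lra.
  exists (Num.max 0 (1 - d / 2)), 1; split => //.
  - by rewrite le_max lexx.
  - by rewrite gt_max ltr01/= ltrBlDr ltrDl divr_gt0.
  move=> x /andP[]; rewrite ge_max => /andP[_ xd] xle1; apply: fd.
  have -> : x0 = 1 by apply/eqP; rewrite eq_le x01.
  by rewrite ger0_norm ?subr_ge0//; lra.
have [c /andP[c0 ca] ec] := @MVT_closed f F 0 a a0 (fun x h => dF01 _ (proj1 (andP h))).
have [c1 /andP[bc1 c11] ec1] : exists2 c, b <= c <= 1 & F 1 - F b = f c * (1 - b).
  apply: MVT_closed => // x /andP[bx _]; apply: dF01.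
  by rewrite (le_trans _ bx)// (le_trans a0)// ltW.
have [c2 hc2 ec2] : exists2 c, a <= c <= b & F b - F a = f c * (b - a).
  apply: MVT_closed => //; first exact: ltW.
  by move=> x /andP[ax _]; apply: dF01; rewrite (le_trans a0).
have -> : F 1 - F 0 = (F 1 - F b) + (F b - F a) + (F a - F 0) by ring.
rewrite ec ec1 ec2 -addrA ltr_wpDl// ?ltr_pwDl//.
- by rewrite mulr_ge0 ?subr_ge0// f0// c11 andbT; lra.
- by rewrite mulr_gt0 ?subr_gt0// fab.
- by rewrite mulr_ge0 ?subr_ge0// f0// c0/=; lra.
Qed.

(** F (x + 1) - F x has derivative f (x + 1) - f x = 0 for an antiderivative F. *)
Lemma unit_integral_shift f (a : R) : continuous f ->
  (forall x, f (x + 1) = f x) ->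
  unit_integral (fun x => f (x + a)) = unit_integral f.
Proof.
move=> cf f1.
have [F dF] := ex_antiderivative (- `|a| - 1) cf.
have dFs b x : - `|a| - 1 < x + b -> is_derive x 1 (fun y => F (y + b)) (f (x + b)).
  move=> xb; have dFx := dF _ xb.
  have ds : is_derive x 1 (fun y => y + b) 1 by exact: is_derive_shift.
  have -> : f (x + b) = f (x + b) * 1 by rewrite mulr1.
  exact: is_derive1_comp.
have aN : - `|a| <= a by rewrite lerNl -normrN ler_norm.
have -> : unit_integral (fun x => f (x + a)) = F (1 + a) - F (0 + a).
  apply: (@unit_integral_FTC (fun x => f (x + a)) (fun x => F (x + a))).
    by move=> x; apply: continuous_comp; [exact: (cvgD cvg_id (cvg_cst _))|exact: cf].
  by move=> x /andP[x0 _]; apply: dFs; lra.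
have -> : unit_integral f = F 1 - F 0.
  apply: unit_integral_FTC => // x /andP[x0 _].
  by apply: dF; have := normr_ge0 a; lra.
pose G x := F (x + 1) - F x.
have dG x : - `|a| - 1 < x -> is_derive x 1 G 0.
  move=> xa; have dFx := dF _ xa; have dFx1 : is_derive x 1 (fun y => F (y + 1)) (f (x + 1)).
    by apply: dFs; lra.
  by have -> : 0 = f (x + 1) - f x :> R; [rewrite f1 subrr|exact: is_deriveB].
have GE x y : x <= y -> - `|a| - 1 < x -> G x = G y.
  move=> xy xa.
  have [c _] := @MVT_closed (fun=> 0) G x y xy (fun z h => dG z (lt_le_trans xa (proj1 (andP h)))).
  by rewrite mul0r => /eqP; rewrite subr_eq0 => /eqP.
have -> : F (1 + a) - F (0 + a) = G a by rewrite /G add0r [1 + a]addrC.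
have -> : F 1 - F 0 = G 0 by rewrite /G add0r.
have [a0|a0] := leP 0 a; first by rewrite -(GE 0 a)//; have := normr_ge0 a; lra.
by rewrite (GE a 0)//; [exact: ltW|lra].
Qed.

End UnitIntegral.

(** * Continuity of vector-valued functions *)
Section MatrixContinuity.
Context {R : realType}.

Lemma continuous_mx {T : topologicalType} m n (F : T -> 'M[R]_(m, n)) :
  (forall i j, continuous (fun x => F x i j)) -> continuous F.
Proof.
move=> cF x A [P FP sPA]; rewrite nbhs_filterE.
have : \forall y \near x, forall ij : 'I_m * 'I_n, P ij.1 ij.2 (F y ij.1 ij.2).
  by apply: filter_forall => -[i j]; exact: (cF i j x _ (FP i j)).
by apply: filterS => y FyP; apply: sPA => i j; exact: (FyP (i, j)).
Qed.

Section scalar_functions.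
Context {T : topologicalType}.
Implicit Types f g : T -> R.

Lemma continuous_fcst (a : R) : continuous (fun _ : T => a).
Proof. by move=> x; exact: cvg_cst. Qed.

Lemma continuous_fD f g : continuous f -> continuous g ->
  continuous (fun x => f x + g x).
Proof. by move=> cf cg x; exact: (cvgD (cf x) (cg x)). Qed.

Lemma continuous_fB f g : continuous f -> continuous g ->
  continuous (fun x => f x - g x).
Proof. by move=> cf cg x; exact: (cvgB (cf x) (cg x)). Qed.

Lemma continuous_fN f : continuous f -> continuous (fun x => - f x).
Proof. by move=> cf x; exact: (cvgN (cf x)). Qed.

Lemma continuous_fM f g : continuous f -> continuous g ->
  continuous (fun x => f x * g x).
Proof. by move=> cf cg x; exact: (cvgM (cf x) (cg x)). Qed.

Lemma continuous_fX f n : continuous f -> continuous (fun x => f x ^+ n).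
Proof.
move=> cf; elim: n => [|n IH].
  by under eq_fun do rewrite expr0; exact: continuous_fcst.
by under eq_fun do rewrite exprS; exact: continuous_fM.
Qed.

Lemma continuous_fsum (I : Type) (r : seq I) (P : pred I) (F : I -> T -> R) :
  (forall i, continuous (F i)) -> continuous (fun x => \sum_(i <- r | P i) F i x).
Proof.
move=> cF; elim: r => [|i r IH].
  by under eq_fun do rewrite big_nil; exact: continuous_fcst.
under eq_fun do rewrite big_cons.
by case: (P i) => //; exact: continuous_fD.
Qed.

Lemma continuous_fprod (I : Type) (r : seq I) (P : pred I) (F : I -> T -> R) :
  (forall i, continuous (F i)) -> continuous (fun x => \prod_(i <- r | P i) F i x).
Proof.
move=> cF; elim: r => [|i r IH].
  by under eq_fun do rewrite big_nil; exact: continuous_fcst.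
under eq_fun do rewrite big_cons.
by case: (P i) => //; exact: continuous_fM.
Qed.

End scalar_functions.

Lemma continuous_fcomp {T U V : topologicalType} (f : T -> U) (g : U -> V) :
  continuous f -> continuous g -> continuous (fun x => g (f x)).
Proof. by move=> cf cg x; apply: continuous_comp; [exact: cf|exact: cg]. Qed.

Lemma continuous_mulmxr m n p (B : 'M[R]_(n, p)) :
  continuous (fun x : 'M[R]_(m, n) => x *m B).
Proof.
apply: continuous_mx => i j.
under eq_fun do rewrite mxE.
apply: continuous_fsum => k; apply: continuous_fM; last exact: continuous_fcst.
exact: coord_continuous.
Qed.

End MatrixContinuity.

(** * The integral over the unit cube *)
Section CubeIntegral.
Context {R : realType}.

Definition unit_cube n : set 'rV[R]_n := [set t | forall i, 0 <= t ord0 i <= 1].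

Lemma compact_unit_cube n : compact (@unit_cube n).
Proof.
have := @rV_compact R n (fun=> `[0, 1]%classic) (fun=> @segment_compact R 0 1).
by congr compact; apply/seteqP; split => t /= h i; have := h i; rewrite in_itv.
Qed.

Definition cons_rV n (t : R) (v : 'rV[R]_n) : 'rV[R]_n.+1 :=
  row_mx (t%:M : 'rV[R]_1) v.

Lemma cons_rV0 n t (v : 'rV[R]_n) : cons_rV t v ord0 ord0 = t.
Proof.
have := row_mxEl (t%:M : 'rV[R]_1) v ord0 ord0.
by rewrite [RHS]mxE eqxx mulr1n => {2}<-; congr (row_mx _ _ _ _); exact/val_inj.
Qed.

Lemma cons_rVS n t (v : 'rV[R]_n) i : cons_rV t v ord0 (lift ord0 i) = v ord0 i.
Proof.
have := row_mxEr (t%:M : 'rV[R]_1) v ord0 i.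
by move=> <-; congr (row_mx _ _ _ _); exact/val_inj.
Qed.

Lemma cons_rVE n (x : 'rV[R]_n.+1) :
  x = cons_rV (x ord0 ord0) (\row_i x ord0 (lift ord0 i)).
Proof.
apply/rowP => i; case: (unliftP ord0 i) => [j ->|->].
  by rewrite cons_rVS mxE.
by rewrite cons_rV0.
Qed.

Lemma unit_cube_cons n t (v : 'rV[R]_n) :
  0 <= t <= 1 -> unit_cube v -> unit_cube (cons_rV t v).
Proof.
move=> t01 v01 i; case: (unliftP ord0 i) => [j ->|->]; first by rewrite cons_rVS.
by rewrite cons_rV0.
Qed.

Lemma cons_rVD n t s (v w : 'rV[R]_n) :
  cons_rV (t + s) (v + w) = cons_rV t v + cons_rV s w.
Proof.
apply/rowP => i; rewrite [RHS]mxE; case: (unliftP ord0 i) => [j ->|->].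
  by rewrite !cons_rVS mxE.
by rewrite !cons_rV0.
Qed.

Lemma continuous_cons_rV {T : topologicalType} n (t : T -> R) (v : T -> 'rV[R]_n) :
  continuous t -> continuous v -> continuous (fun x => cons_rV (t x) (v x)).
Proof.
move=> ct cv; apply: continuous_mx => i j; rewrite (ord1 i).
case: (unliftP ord0 j) => [k ->|->].
  under eq_fun do rewrite cons_rVS.
  exact: (continuous_fcomp cv (@coord_continuous _ _ _ _ _)).
by under eq_fun do rewrite cons_rV0.
Qed.

Section slices.
Context n (f : 'rV[R]_n.+1 -> R) (cf : continuous f).

Lemma continuous_slice t : continuous (fun v => f (cons_rV t v)).
Proof.
apply: (continuous_fcomp _ cf); apply: continuous_cons_rV; last by move=> v; exact: cvg_id.
exact: continuous_fcst.
Qed.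

(** Continuity in the first variable is uniform in the others, by compactness of
    the cube (tube lemma). *)
Lemma slice_near t (e : R) : 0 < e ->
  \forall s \near t, forall v, unit_cube v ->
    `|f (cons_rV s v) - f (cons_rV t v)| < e.
Proof.
move=> e0; have /compact_near_coveringP := @compact_unit_cube n.
move=> /(_ R (nbhs t) (fun s v => `|f (cons_rV s v) - f (cons_rV t v)| < e)) H.
apply: H => v _.
pose g (z : 'rV[R]_n * R) := f (cons_rV z.2 z.1) - f (cons_rV t z.1).
have cg : continuous g.
  apply: continuous_fB; apply: (continuous_fcomp _ cf); apply: continuous_cons_rV.
  - by move=> z; exact: cvg_snd.
  - by move=> z; exact: cvg_fst.
  - exact: continuous_fcst.
  - by move=> z; exact: cvg_fst.
have := @cvgr_norm_lt _ _ _ _ _ _ _ (cg (v, t)) e.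
by rewrite {1}/g/= subrr normr0 => /(_ _ e0); apply.
Qed.

End slices.

Lemma cube_integralS n (f : 'rV[R]_n.+1 -> R) :
  cube_integral f = unit_integral (fun t => cube_integral (fun v => f (cons_rV t v))).
Proof. by []. Qed.

Lemma cube_integral0 (f : 'rV[R]_0 -> R) : cube_integral f = f 0.
Proof. by []. Qed.

Lemma eq_cube_integral n (f g : 'rV[R]_n -> R) :
  (forall x, unit_cube x -> f x = g x) -> cube_integral f = cube_integral g.
Proof.
elim: n f g => [|n IH] f g fg; first by apply: fg => -[].
rewrite !cube_integralS; apply: eq_unit_integral => t t01.
by apply: IH => v v01; exact/fg/unit_cube_cons.
Qed.

(** These properties are bundled because each induction step needs all of them:
    they yield continuity of the inner integral, without which the outer one has
    no properties. *)
Definition cube_linear_monotone n : Prop :=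
  [/\ forall f g : 'rV[R]_n -> R, continuous f -> continuous g ->
        cube_integral (fun x => f x + g x) = cube_integral f + cube_integral g,
     forall (a : R) (f : 'rV[R]_n -> R), continuous f ->
        cube_integral (fun x => a * f x) = a * cube_integral f,
     forall a : R, @cube_integral R n (fun=> a) = a &
     forall f g : 'rV[R]_n -> R, continuous f -> continuous g ->
        (forall x, unit_cube x -> f x <= g x) ->
        cube_integral f <= cube_integral g].

Lemma continuous_partial_integral n (f : 'rV[R]_n.+1 -> R) :
  cube_linear_monotone n -> continuous f ->
  continuous (fun t => cube_integral (fun v => f (cons_rV t v))).
Proof.
move=> [ID _ Ic Ile] cf t; apply/cvgrPdist_le => e e0.
have := slice_near cf t e0; apply: filterS => s sP.
have csl r := @continuous_slice n f cf r.
rewrite ler_distl; apply/andP; split.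
  rewrite lerBlDr -[e in leRHS]Ic -ID//; last exact: continuous_fcst.
  apply: Ile => //; first by apply: continuous_fD => //; exact: continuous_fcst.
  by move=> v /sP/ltW; rewrite ler_distl lerBlDr => /andP[].
rewrite -[e in leRHS]Ic -ID//; last exact: continuous_fcst.
apply: Ile => //; first by apply: continuous_fD => //; exact: continuous_fcst.
by move=> v /sP/ltW; rewrite distrC ler_distl lerBlDr => /andP[].
Qed.

Lemma cube_integral_linear_monotone n : cube_linear_monotone n.
Proof.
elim: n => [|n IHn]; first by split => // f g _ _ fg; apply: fg => -[].
have Icont := fun f => @continuous_partial_integral n f IHn.
have [ID IZ Ic Ile] := IHn; have csl := @continuous_slice n; split.
- move=> f g cf cg; rewrite !cube_integralS -unit_integralD; try exact: Icont.
  by apply: eq_unit_integral => t _; rewrite ID//; exact: csl.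
- move=> a f cf; rewrite !cube_integralS -unit_integralZ; try exact: Icont.
  by apply: eq_unit_integral => t _; rewrite IZ//; exact: csl.
- move=> a; rewrite cube_integralS -[RHS]unit_integral_cst.
  by apply: eq_unit_integral => t _; rewrite Ic.
- move=> f g cf cg fg; rewrite !cube_integralS; apply: le_unit_integral; try exact: Icont.
  move=> t t01; apply: Ile; [exact: csl..|] => v v01.
  exact/fg/unit_cube_cons.
Qed.

Section cube_integral_theory.
Context {n : nat}.
Implicit Types f g : 'rV[R]_n -> R.

Lemma cube_integralD f g : continuous f -> continuous g ->
  cube_integral (fun x => f x + g x) = cube_integral f + cube_integral g.
Proof. by have [+ _ _ _] := cube_integral_linear_monotone n; exact. Qed.

Lemma cube_integralZ (a : R) f : continuous f ->
  cube_integral (fun x => a * f x) = a * cube_integral f.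
Proof. by have [_ + _ _] := cube_integral_linear_monotone n; exact. Qed.

Lemma cube_integral_cst (a : R) : @cube_integral R n (fun=> a) = a.
Proof. by have [_ _ + _] := cube_integral_linear_monotone n; exact. Qed.

Lemma le_cube_integral f g : continuous f -> continuous g ->
  (forall x, unit_cube x -> f x <= g x) -> cube_integral f <= cube_integral g.
Proof. by have [_ _ _ +] := cube_integral_linear_monotone n; exact. Qed.

Lemma continuous_cube_integral (f : 'rV[R]_n.+1 -> R) : continuous f ->
  continuous (fun t => cube_integral (fun v => f (cons_rV t v))).
Proof. by apply: continuous_partial_integral; exact: cube_integral_linear_monotone. Qed.

Lemma cube_integral_ge0 f : continuous f -> (forall x, unit_cube x -> 0 <= f x) ->
  0 <= cube_integral f.
Proof.
move=> cf f0; rewrite -[leLHS]cube_integral_cst; apply: le_cube_integral => //.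
exact: continuous_fcst.
Qed.

End cube_integral_theory.

Lemma cube_integral_gt0 n (f : 'rV[R]_n -> R) x0 : continuous f ->
  (forall x, unit_cube x -> 0 <= f x) -> unit_cube x0 -> 0 < f x0 ->
  0 < cube_integral f.
Proof.
elim: n f x0 => [|n IH] f x0 cf f0 x00 fx0.
  by rewrite cube_integral0 (_ : 0 = x0)//; apply/rowP => -[].
rewrite cube_integralS; apply: (@unit_integral_gt0 _ _ (x0 ord0 ord0)) => //.
- exact: continuous_cube_integral.
- move=> t t01; apply: cube_integral_ge0; first exact: continuous_slice.
  by move=> v v01; exact/f0/unit_cube_cons.
- apply: (IH _ (\row_i x0 ord0 (lift ord0 i))).
  + exact: continuous_slice.
  + by move=> v v01; exact/f0/unit_cube_cons.
  + by move=> i; rewrite mxE.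
  + by rewrite -cons_rVE.
Qed.

Definition Zperiodic n (f : 'rV[R]_n -> R) :=
  forall (k : 'I_n -> int) x, f (x + \row_i (k i)%:~R) = f x.

(** One variable at a time, from unit_integral_shift. *)
Lemma cube_integral_shift n (f : 'rV[R]_n -> R) (a : 'rV[R]_n) : continuous f ->
  Zperiodic f -> cube_integral (fun x => f (x + a)) = cube_integral f.
Proof.
elim: n f a => [|n IH] f a cf pf.
  by rewrite !cube_integral0; congr f; apply/rowP => -[].
rewrite [a]cons_rVE.
set a0 := a ord0 ord0; set a1 := \row_i _.
rewrite !cube_integralS.
transitivity (unit_integral (fun t => cube_integral (fun v => f (cons_rV (t + a0) v)))).
  apply: eq_unit_integral => t _.
  rewrite -(IH (fun v => f (cons_rV (t + a0) v)) a1); last 2 first.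
  - exact: continuous_slice.
  - move=> k x; rewrite -[t + a0]addr0 cons_rVD.
    rewrite (_ : cons_rV 0 _ = \row_i (odflt 0 (omap k (unlift ord0 i)))%:~R).
      by rewrite pf addr0.
    apply/rowP => i; rewrite [RHS]mxE; case: (unliftP ord0 i) => [j ->|->] /=.
      by rewrite cons_rVS mxE.
    by rewrite cons_rV0.
  by apply: eq_cube_integral => v _; rewrite cons_rVD.
apply: (unit_integral_shift _ (continuous_cube_integral cf)) => t.
apply: eq_cube_integral => v _.
rewrite -[v in LHS]addr0 cons_rVD.
rewrite (_ : cons_rV 1 _ = \row_i ((i == ord0) : nat)%:~R) ?pf//.
apply/rowP => i; rewrite [RHS]mxE; case: (unliftP ord0 i) => [j ->|->] /=.
  by rewrite cons_rVS mxE.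
by rewrite cons_rV0.
Qed.

End CubeIntegral.

(** * Uniqueness of Fourier coefficients on the cube *)
Section Phase.
Context {R : realType} {n : nat}.
Implicit Types (k l : 'rV[int]_n) (t : 'rV[R]_n).

Definition phase k t : R := 2 * pi * \sum_i (k ord0 i)%:~R * t ord0 i.

Lemma phaseDl k l t : phase (k + l) t = phase k t + phase l t.
Proof.
rewrite /phase -mulrDr -big_split/=; congr (_ * _); apply: eq_bigr => i _.
by rewrite mxE intrD mulrDl.
Qed.

Lemma phaseNl k t : phase (- k) t = - phase k t.
Proof.
rewrite /phase -mulrN -sumrN; congr (_ * _); apply: eq_bigr => i _.
by rewrite mxE intrN mulNr.
Qed.

Lemma phaseDr k s t : phase k (s + t) = phase k s + phase k t.
Proof.
rewrite /phase -mulrDr -big_split/=; congr (_ * _); apply: eq_bigr => i _.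
by rewrite mxE mulrDr.
Qed.

Lemma phase0l t : phase 0 t = 0.
Proof. by rewrite /phase big1 ?mulr0// => i _; rewrite mxE mul0r. Qed.

Lemma phase_delta i t : phase (delta_mx ord0 i) t = 2 * pi * t ord0 i.
Proof.
rewrite /phase (bigD1 i)//= big1 ?addr0; last first.
  by move=> j ji; rewrite mxE (negPf ji) andbF mul0r.
by rewrite mxE !eqxx mul1r.
Qed.

Lemma continuous_phase k : continuous (phase k).
Proof.
apply: continuous_fM; first exact: continuous_fcst.
apply: continuous_fsum => i; apply: continuous_fM; first exact: continuous_fcst.
exact: coord_continuous.
Qed.

Lemma continuous_cos_phase k : continuous (fun t => cos (phase k t)).
Proof. exact: (continuous_fcomp (@continuous_phase k) (@continuous_cos R)). Qed.

Lemma continuous_sin_phase k : continuous (fun t => sin (phase k t)).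
Proof. exact: (continuous_fcomp (@continuous_phase k) (@continuous_sin R)). Qed.

Lemma cosD2piz (x : R) (z : int) : cos (x + 2 * pi * z%:~R) = cos x.
Proof.
have H (y : R) (m : nat) : cos (y + 2 * pi * m%:R) = cos y.
  have -> : 2 * pi * m%:R = pi *+ 2 *+ m :> R by rewrite mulr_natr mulr2n mulrDl mul1r.
  exact: (periodicn (@cosD2pi R)).
case: z => m; first exact: H.
rewrite NegzE -(H (x + _) m.+1); congr cos.
by rewrite intrN mulrN -pmulrn subrK.
Qed.

Lemma sinD2piz (x : R) (z : int) : sin (x + 2 * pi * z%:~R) = sin x.
Proof.
have H (y : R) (m : nat) : sin (y + 2 * pi * m%:R) = sin y.
  have -> : 2 * pi * m%:R = pi *+ 2 *+ m :> R by rewrite mulr_natr mulr2n mulrDl mul1r.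
  exact: (periodicn (@sinD2pi R)).
case: z => m; first exact: H.
rewrite NegzE -(H (x + _) m.+1); congr sin.
by rewrite intrN mulrN -pmulrn subrK.
Qed.

Lemma phase_int k (l : 'I_n -> int) :
  phase k (\row_i (l i)%:~R) = 2 * pi * (\sum_i k ord0 i * l i)%:~R.
Proof.
rewrite /phase rmorph_sum/=; congr (_ * _); apply: eq_bigr => i _.
by rewrite mxE intrM.
Qed.

Lemma Zperiodic_cos_phase k : Zperiodic (fun t => cos (phase k t)).
Proof. by move=> l x; rewrite phaseDr phase_int cosD2piz. Qed.

Lemma Zperiodic_sin_phase k : Zperiodic (fun t => sin (phase k t)).
Proof. by move=> l x; rewrite phaseDr phase_int sinD2piz. Qed.

Lemma ZperiodicM (f g : 'rV[R]_n -> R) : Zperiodic f -> Zperiodic g ->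
  Zperiodic (fun t => f t * g t).
Proof. by move=> pf pg k x; rewrite pf pg. Qed.

End Phase.

Section FourierUniqueness.
Context {R : realType} {n : nat}.
Implicit Types (k l : 'rV[int]_n) (t : 'rV[R]_n) (f g h : 'rV[R]_n -> R).

Definition fourier_null f := forall k,
  cube_integral (fun t => f t * cos (phase k t)) = 0 /\
  cube_integral (fun t => f t * sin (phase k t)) = 0.

Lemma fourier_null_mul_cos f l : continuous f -> fourier_null f ->
  fourier_null (fun t => f t * ((1 + cos (phase l t)) / 2)).
Proof.
move=> cf nf k.
have cfc m : continuous (fun t => f t * cos (phase m t)).
  by apply: continuous_fM => //; exact: continuous_cos_phase.
have cfs m : continuous (fun t => f t * sin (phase m t)).
  by apply: continuous_fM => //; exact: continuous_sin_phase.
have cZ (a : R) h : continuous h -> continuous (fun t => a * h t).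
  by apply: continuous_fM; exact: continuous_fcst.
split.
  rewrite [LHS](_ : _ = cube_integral (fun t => 2^-1 * (f t * cos (phase k t)) +
     (4^-1 * (f t * cos (phase (k + l) t)) + 4^-1 * (f t * cos (phase (k - l) t))))).
    rewrite !cube_integralD; try by do ?apply: continuous_fD; exact: cZ.
    by rewrite !cube_integralZ// !(nf _).1 !mulr0 !addr0.
  apply: eq_cube_integral => t _.
  by rewrite !phaseDl phaseNl cosB cosD; field.
rewrite [LHS](_ : _ = cube_integral (fun t => 2^-1 * (f t * sin (phase k t)) +
   (4^-1 * (f t * sin (phase (k + l) t)) + 4^-1 * (f t * sin (phase (k - l) t))))).
  rewrite !cube_integralD; try by do ?apply: continuous_fD; exact: cZ.
  by rewrite !cube_integralZ// !(nf _).2 !mulr0 !addr0.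
apply: eq_cube_integral => t _.
by rewrite !phaseDl phaseNl sinB sinD; field.
Qed.

(** cos^2 (pi t_i); peak has value 1 at the integer points and is smaller
    elsewhere, so its powers concentrate there. *)
Definition peak_factor (i : 'I_n) t : R := (1 + cos (phase (delta_mx ord0 i) t)) / 2.
Definition peak t : R := \prod_i peak_factor i t.

Lemma peak_factor01 i t : 0 <= peak_factor i t <= 1.
Proof.
rewrite /peak_factor; have := cos_le1 (phase (delta_mx ord0 i) t).
by have := cos_geN1 (phase (delta_mx ord0 i) t); lra.
Qed.

Lemma peak01 t : 0 <= peak t <= 1.
Proof.
rewrite /peak; apply/andP; split; first by apply: prodr_ge0 => i _; case/andP: (peak_factor01 i t).
by apply: prodr_ile1 => i _; exact: peak_factor01.
Qed.

Lemma peak0 : peak 0 = 1.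
Proof.
by rewrite /peak big1// => i _; rewrite /peak_factor phase_delta mxE mulr0 cos0; lra.
Qed.

Lemma peak_le i t : peak t <= peak_factor i t.
Proof.
rewrite /peak (bigD1 i)//=; have /andP[h0 h1] := peak_factor01 i t.
rewrite -[leRHS]mulr1 ler_wpM2l//; apply: prodr_ile1 => j _; exact: peak_factor01.
Qed.

Lemma continuous_peak_factor i : continuous (peak_factor i).
Proof.
apply: continuous_fM; last exact: continuous_fcst.
by apply: continuous_fD; [exact: continuous_fcst|exact: continuous_cos_phase].
Qed.

Lemma continuous_peak : continuous peak.
Proof. by apply: continuous_fprod => i; exact: continuous_peak_factor. Qed.

Lemma Zperiodic_peak : Zperiodic peak.
Proof.
move=> k x; rewrite /peak; apply: eq_bigr => i _; rewrite /peak_factor.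
by rewrite Zperiodic_cos_phase.
Qed.

(** peak^N is a trigonometric polynomial. *)
Lemma fourier_null_peak f N : continuous f -> fourier_null f ->
  fourier_null (fun t => f t * peak t ^+ N).
Proof.
move=> cf nf.
have H (r : seq 'I_n) h : continuous h -> fourier_null h ->
    fourier_null (fun t => h t * \prod_(i <- r) peak_factor i t).
  elim: r h => [|i r IH] h ch nh.
    by under eq_fun do rewrite big_nil mulr1.
  under eq_fun do rewrite big_cons mulrA.
  apply: (IH (fun t => h t * peak_factor i t)); last exact: fourier_null_mul_cos.
  by apply: continuous_fM => //; exact: continuous_peak_factor.
elim: N => [|N IH]; first by under eq_fun do rewrite expr0 mulr1.
under eq_fun do rewrite exprSr mulrA.
apply: (H _ (fun t => f t * peak t ^+ N)) => //.
by apply: continuous_fM => //; apply: continuous_fX; exact: continuous_peak.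
Qed.

Lemma round_rV t : exists k : 'I_n -> int,
  forall i, `|(t + \row_i (k i)%:~R) ord0 i| <= 2^-1.
Proof.
exists (fun i => - Num.floor (t ord0 i + 2^-1)) => i; rewrite !mxE intrN.
have := floor_itv (t ord0 i + 2^-1); rewrite intrD => /andP[h1 h2].
by rewrite ler_norml; lra.
Qed.

(** If f 0 > 0, then f >= f 0 / 2 near 0, and the integral of f * peak^N,
    which is 0, is at least (f 0 / 2) I (peak^N) minus a constant times c^N, where
    c < 1 bounds peak away from the integer points.  But I (peak^N) is at least a
    positive multiple of e^N for any e in (c, 1), as peak > e on a nonempty open
    set: a contradiction for large N. *)
Lemma fourier_null_le0 f : continuous f -> Zperiodic f -> fourier_null f -> f 0 <= 0.
Proof.
move=> cf pf nf; rewrite leNgt; apply/negP => f0.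
have [d [d0 d2 fd]] : exists d : R, [/\ 0 < d, d <= 2^-1 &
    forall t, (forall i, `|t ord0 i| < d) -> f 0 / 2 < f t].
  have : \forall x \near (0 : 'rV[R]_n), f 0 / 2 < f x.
    by apply: (cvgr_gt (f 0) (cf 0)); lra.
  move=> /nbhs_ballP[d /= d0 fd]; exists (Num.min d 2^-1); split.
  - by rewrite lt_min d0/= invr_gt0.
  - by rewrite ge_min lexx orbT.
  - move=> t td; apply: fd; split => // i j; rewrite (ord1 i) /ball/= mxE sub0r normrN.
    by apply: lt_le_trans (td j) _; rewrite ge_min lexx.
have [M M0 fM] : exists2 M : R, 0 <= M & forall t, `|f t| <= M.
  have cC : compact [set t : 'rV[R]_n | forall i, `[(-1), 1]%classic (t ord0 i)].
    by apply: (@rV_compact R n (fun=> `[(-1), 1]%classic)) => _; exact: segment_compact.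
  have /compact_bounded[M [_ MP]] := continuous_compact (continuous_subspaceT cf) cC.
  exists (`|M| + 1); first by rewrite addr_ge0.
  move=> t; have [k kP] := round_rV t; rewrite -(pf k t); apply: MP => //.
    by rewrite (le_lt_trans (ler_norm _))// ltrDl.
  exists (t + \row_i (k i)%:~R) => // i /=; rewrite in_itv/= -ler_norml.
  by apply: le_trans (kP i) _; lra.
pose c : R := (1 + cos (2 * pi * d)) / 2.
have pi0 := @pi_gt0 R.
have half_pi (x : R) : 0 <= x <= 2^-1 -> 0 <= 2 * pi * x <= pi.
  move=> /andP[x0 x1]; apply/andP; split; first by rewrite !mulr_ge0// ltW.
  have : 0 <= pi * (2^-1 - x) by rewrite mulr_ge0 ?subr_ge0// ltW.
  by rewrite mulrBr; lra.
have d01 : 0 <= 2 * pi * d <= pi by apply: half_pi; rewrite ltW.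
have c0 : 0 <= c by have := cos_geN1 (2 * pi * d); rewrite /c; lra.
have c1 : c < 1.
  suff : cos (2 * pi * d) < cos 0 by rewrite cos0 /c; lra.
  by rewrite ltr_cos ?in_itv/= ?lexx ?(ltW pi0)// !mulr_gt0.
(* peak is small at a point of [-1/2, 1/2]^n with a coordinate not in (-d, d) *)
have far t i : `|t ord0 i| <= 2^-1 -> d <= `|t ord0 i| -> peak t <= c.
  move=> t2 dt; apply: (le_trans (peak_le i t)).
  rewrite /peak_factor /c phase_delta ler_pM2r ?invr_gt0// lerD2l.
  have -> : cos (2 * pi * t ord0 i) = cos (2 * pi * `|t ord0 i|).
    by rewrite -cos_norm normrM (ger0_norm (_ : 0 <= 2 * pi))// mulr_ge0// ltW.
  have ht : 0 <= 2 * pi * `|t ord0 i| <= pi by apply: half_pi; rewrite normr_ge0.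
  by rewrite leNgt ltr_cos ?in_itv//= -leNgt ler_pM2l// mulr_gt0.
have key N t : f 0 / 2 * peak t ^+ N - (M + f 0 / 2) * c ^+ N <= f t * peak t ^+ N.
  have [k kP] := round_rV t; rewrite -(pf k t) -(Zperiodic_peak k t).
  set s := t + _ in kP *.
  have Q0 : 0 <= peak s ^+ N by apply: exprn_ge0; case/andP: (peak01 s).
  have cN0 : 0 <= c ^+ N by exact: exprn_ge0.
  have [/forallP sd|] := boolP [forall i, `|s ord0 i| < d].
    have h1 : f 0 / 2 * peak s ^+ N <= f s * peak s ^+ N.
      by rewrite ler_wpM2r// ltW// fd.
    rewrite lerBlDr; apply: (le_trans h1).
    by rewrite lerDl mulr_ge0//; lra.
  rewrite negb_forall => /existsP[j]; rewrite -leNgt => dsj.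
  have Qc : peak s ^+ N <= c ^+ N.
    by rewrite lerXn2r ?nnegrE//; [case/andP: (peak01 s)|exact: far dsj].
  have h1 : (f 0 / 2 - f s) * peak s ^+ N <= (M + f 0 / 2) * c ^+ N.
    apply: (@le_trans _ _ ((M + f 0 / 2) * peak s ^+ N)).
      rewrite ler_wpM2r// addrC lerD2r//.
      by have := fM s; rewrite ler_norml; lra.
    by rewrite ler_wpM2l//; lra.
  by move: h1; rewrite mulrBl; lra.
have cQN N : continuous (fun t => peak t ^+ N) by apply: continuous_fX; exact: continuous_peak.
have key2 N : f 0 / 2 * cube_integral (fun t => peak t ^+ N) <= (M + f 0 / 2) * c ^+ N.
  have := (fourier_null_peak N cf nf 0).1.
  under eq_fun do rewrite phase0l cos0 mulr1.
  move=> I0; rewrite -cube_integralZ// -[leRHS]add0r -{1}I0 -lerBlDr.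
  rewrite -mulN1r -{1}(@cube_integral_cst R n ((M + f 0 / 2) * c ^+ N)).
  rewrite -cube_integralZ; last exact: continuous_fcst.
  have cp : continuous (fun t => f 0 / 2 * peak t ^+ N).
    by apply: continuous_fM; [exact: continuous_fcst|exact: cQN].
  rewrite -cube_integralD//; last exact: continuous_fcst.
  apply: le_cube_integral.
  - by apply: continuous_fD => //; exact: continuous_fcst.
  - exact: continuous_fM.
  - by move=> t _; rewrite mulN1r; exact: key.
(* twice the positive part of peak - e: a continuous substitute for the
   indicator function of the set where peak > e *)
pose e : R := (1 + c) / 2.
pose bump t : R := `|peak t - e| + (peak t - e).
have cb : continuous bump.
  have cpe : continuous (fun t => peak t - e).
    by apply: continuous_fB; [exact: continuous_peak|exact: continuous_fcst].
  apply: continuous_fD => //; apply: (continuous_fcomp cpe).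
  exact: norm_continuous.
have b0 : 0 < cube_integral bump.
  apply: (@cube_integral_gt0 _ _ _ 0) => //.
  - by move=> t _; rewrite /bump; have := ler_norm (- (peak t - e)); rewrite normrN; lra.
  - by move=> i; rewrite mxE lexx ler01.
  - by rewrite /bump peak0 /e ger0_norm; lra.
have key3 N : e ^+ N / 2 * cube_integral bump <= cube_integral (fun t => peak t ^+ N).
  rewrite -cube_integralZ//; apply: le_cube_integral => //.
    by apply: continuous_fM => //; exact: continuous_fcst.
  move=> t _; have /andP[p0 p1] := peak01 t.
  have [pe|pe] := leP e (peak t).
    rewrite /bump ger0_norm ?subr_ge0//.
    apply: (@le_trans _ _ (e ^+ N * 1)).
      rewrite -mulrA ler_wpM2l ?exprn_ge0//; rewrite /e; lra.
    by rewrite mulr1 lerXn2r ?nnegrE//; rewrite /e; lra.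
  by rewrite /bump ltr0_norm ?subr_lt0// addNr mulr0 exprn_ge0.
pose K := f 0 / 2 * (cube_integral bump / 2).
have K0 : 0 < K by rewrite /K !mulr_gt0// ?invr_gt0//; lra.
have e0 : 0 < e by rewrite /e; lra.
have key4 N : K <= (M + f 0 / 2) * (c / e) ^+ N.
  rewrite expr_div_n mulrA ler_pdivlMr ?exprn_gt0//.
  apply: le_trans (key2 N); rewrite /K -(mulrA (f 0 / 2)).
  have f2 : 0 <= f 0 / 2 by lra.
  rewrite ler_wpM2l//; apply: le_trans (key3 N).
  by rewrite le_eqVlt; apply/orP; left; apply/eqP; ring.
have ce1 : `|c / e| < 1.
  have ce0 : 0 <= c / e by rewrite divr_ge0// ltW.
  by rewrite ger0_norm// ltr_pdivrMr// mul1r /e; lra.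
have cv : ((M + f 0 / 2) * (c / e) ^+ N) @[N --> \oo] --> (0 : R).
  exact: (cvg_geometric (M + f 0 / 2) ce1).
have := limr_ge (cvgP _ cv) (nearW _ key4).
rewrite (cvg_lim _ cv)// => /(_ _ _); rewrite leNgt K0 => H.
by have : false by exact: H.
Qed.

(** Apply fourier_null_le0 to f and - f translated by t0. *)
Lemma fourier_unique f : continuous f -> Zperiodic f -> fourier_null f ->
  forall t, f t = 0.
Proof.
move=> cf pf nf t0.
have nfs : fourier_null (fun t => f (t + t0)).
  have cc k := continuous_fM cf (@continuous_cos_phase R n k).
  have cs k := continuous_fM cf (@continuous_sin_phase R n k).
  have pc k := ZperiodicM pf (@Zperiodic_cos_phase R n k).
  have ps k := ZperiodicM pf (@Zperiodic_sin_phase R n k).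
  have cZ (a : R) h : continuous h -> continuous (fun t => a * h t).
    by apply: continuous_fM; exact: continuous_fcst.
  have pZ (a : R) h : Zperiodic h -> Zperiodic (fun t => a * h t).
    by move=> ph k x; rewrite ph.
  move=> k; split.
    pose h t := cos (phase k t0) * (f t * cos (phase k t)) +
                sin (phase k t0) * (f t * sin (phase k t)).
    rewrite (_ : cube_integral _ = cube_integral (fun t => h (t + t0))).
      rewrite cube_integral_shift.
      - by rewrite cube_integralD ?cube_integralZ//;
           [rewrite !(nf _).1 !(nf _).2 !mulr0 addr0|exact: cZ|exact: cZ].
      - by apply: continuous_fD; exact: cZ.
      - by move=> l x; rewrite /h pf Zperiodic_cos_phase Zperiodic_sin_phase.
    apply: eq_cube_integral => t _; rewrite /h.
    by rewrite [in LHS](_ : phase k t = phase k (t + t0) - phase k t0);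
       [rewrite cosB; ring|rewrite phaseDr addrK].
  pose h t := cos (phase k t0) * (f t * sin (phase k t)) +
              (- sin (phase k t0)) * (f t * cos (phase k t)).
  rewrite (_ : cube_integral _ = cube_integral (fun t => h (t + t0))).
    rewrite cube_integral_shift.
    - by rewrite cube_integralD ?cube_integralZ//;
         [rewrite !(nf _).1 !(nf _).2 !mulr0 addr0|exact: cZ|exact: cZ].
    - by apply: continuous_fD; exact: cZ.
    - by move=> l x; rewrite /h pf Zperiodic_cos_phase Zperiodic_sin_phase.
  apply: eq_cube_integral => t _; rewrite /h.
  by rewrite [in LHS](_ : phase k t = phase k (t + t0) - phase k t0);
     [rewrite sinB; ring|rewrite phaseDr addrK].
have cfs : continuous (fun t => f (t + t0)).
  by apply: (continuous_fcomp _ cf) => x; exact: (cvgD cvg_id (cvg_cst _)).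
have pfs : Zperiodic (fun t => f (t + t0)) by move=> k x; rewrite addrAC pf.
have h1 := fourier_null_le0 cfs pfs nfs.
have h2 : - f (0 + t0) <= 0.
  apply: (@fourier_null_le0 (fun t => - f (t + t0))).
  - exact: continuous_fN.
  - by move=> k x; rewrite pfs.
  - move=> k; have [nfc nfsn] := nfs k.
    have cc := continuous_fM cfs (@continuous_cos_phase R n k).
    have cs := continuous_fM cfs (@continuous_sin_phase R n k).
    split.
      rewrite (_ : cube_integral _ = cube_integral (fun t => -1 * (f (t + t0) * cos (phase k t)))).
        by rewrite cube_integralZ// nfc mulr0.
      by apply: eq_cube_integral => t _; ring.
    rewrite (_ : cube_integral _ = cube_integral (fun t => -1 * (f (t + t0) * sin (phase k t)))).
      by rewrite cube_integralZ// nfsn mulr0.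
    by apply: eq_cube_integral => t _; ring.
by move: h1 h2; rewrite add0r oppr_le0 => h1 h2; apply/eqP; rewrite eq_le h1 h2.
Qed.

End FourierUniqueness.

(** * The mean over the torus and integration by parts *)
Section Mean.
Context {R : realType} {n : nat} (B : 'M[R]_n) (Bu : B \in unitmx).
Implicit Types (f g : 'rV[R]_n -> R) (x v w t : 'rV[R]_n) (a : R).

Definition rperiodic f := forall v x, Zspan B v -> f (x + v) = f x.

(** The integral over the torus, normalised to give 1 on the constant 1. *)
Definition mean f : R := cube_integral (fun t => f (t *m B)).

Lemma continuous_coords f : continuous f -> continuous (fun t => f (t *m B)).
Proof. exact: (continuous_fcomp (@continuous_mulmxr R 1 n n B)). Qed.

Lemma Zspan_mul (k : 'I_n -> int) : Zspan B ((\row_i (k i)%:~R) *m B).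
Proof.
exists k; rewrite mulmx_sum_row; apply: eq_bigr => i _.
by rewrite mxE.
Qed.

Lemma Zperiodic_coords f : rperiodic f -> Zperiodic (fun t => f (t *m B)).
Proof. by move=> pf k t; rewrite mulmxDl pf//; exact: Zspan_mul. Qed.

Lemma reduce_cube x : exists v t, [/\ Zspan B v, unit_cube t & x + v = t *m B].
Proof.
pose k i : int := - Num.floor ((x *m invmx B) ord0 i).
exists ((\row_i (k i)%:~R) *m B), (x *m invmx B + \row_i (k i)%:~R); split.
- exact: Zspan_mul.
- move=> i; set y := x *m invmx B.
  have -> : (y + \row_i (k i)%:~R) ord0 i = y ord0 i - (Num.floor (y ord0 i))%:~R.
    by rewrite mxE [X in _ + X]mxE /k intrN.
  by have := floor_itv (y ord0 i); rewrite intrD => /andP[h1 h2]; lra.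
- by rewrite mulmxDl mulmxKV.
Qed.

Lemma mean_shift f v : continuous f -> rperiodic f ->
  mean (fun x => f (x + v)) = mean f.
Proof.
move=> cf pf; rewrite /mean.
rewrite -(cube_integral_shift (v *m invmx B) (continuous_coords cf) (Zperiodic_coords pf)).
by apply: eq_cube_integral => t _; rewrite mulmxDl mulmxKV.
Qed.

Lemma meanD f g : continuous f -> continuous g ->
  mean (fun x => f x + g x) = mean f + mean g.
Proof. by move=> cf cg; rewrite /mean cube_integralD//; exact: continuous_coords. Qed.

Lemma meanZ a f : continuous f -> mean (fun x => a * f x) = a * mean f.
Proof. by move=> cf; rewrite /mean cube_integralZ//; exact: continuous_coords. Qed.

Lemma meanN f : continuous f -> mean (fun x => - f x) = - mean f.
Proof.
move=> cf; rewrite -mulN1r -meanZ//.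
by congr mean; apply/funext => x; rewrite mulN1r.
Qed.

Lemma meanB f g : continuous f -> continuous g ->
  mean (fun x => f x - g x) = mean f - mean g.
Proof. by move=> cf cg; rewrite meanD ?meanN//; exact: continuous_fN. Qed.

Lemma mean_cst a : mean (fun=> a) = a.
Proof. exact: cube_integral_cst. Qed.

Lemma le_mean f g : continuous f -> continuous g -> (forall x, f x <= g x) ->
  mean f <= mean g.
Proof. by move=> cf cg fg; apply: le_cube_integral => //; exact: continuous_coords. Qed.

Lemma mean_eq0 f : continuous f -> rperiodic f -> (forall x, 0 <= f x) ->
  mean f = 0 -> forall x, f x = 0.
Proof.
move=> cf pf f0 mf x; apply/eqP; rewrite eq_le f0 andbT leNgt; apply/negP => fx.
have [v [t [Lv ct xv]]] := reduce_cube x.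
have : 0 < mean f.
  apply: (cube_integral_gt0 (continuous_coords cf) _ ct) => //.
  by rewrite -xv pf.
by rewrite mf ltxx.
Qed.

(** By periodicity it suffices to let x range over the compact parallelepiped
    spanned by the basis. *)
Lemma uniform_continuity g v (e : R) : continuous g -> rperiodic g -> 0 < e ->
  exists2 d : R, 0 < d & forall r x, `|r| < d -> `|g (x + r *: v) - g x| < e.
Proof.
move=> cg pg e0; have /compact_near_coveringP := @compact_unit_cube R n.
move=> /(_ R (nbhs (0 : R)) (fun r t => `|g (t *m B + r *: v) - g (t *m B)| < e)) H.
have : \forall r \near (0 : R), forall t, unit_cube t -> `|g (t *m B + r *: v) - g (t *m B)| < e.
  apply: H => t _.
  pose h (z : 'rV[R]_n * R) := g (z.1 *m B + z.2 *: v) - g (z.1 *m B).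
  have c1 : continuous (fun z : 'rV[R]_n * R => z.1 *m B).
    apply: (@continuous_fcomp _ _ _ fst (fun x : 'rV[R]_n => x *m B)).
      by move=> z; exact: cvg_fst.
    exact: continuous_mulmxr.
  have ch : continuous h.
    apply: continuous_fB; last exact: (continuous_fcomp c1 cg).
    apply: (continuous_fcomp _ cg) => z; apply: cvgD; first exact: c1.
    by apply: cvgZr_tmp; exact: cvg_snd.
  have := @cvgr_norm_lt _ _ _ _ _ _ _ (ch (t, 0)) e.
  by rewrite {1}/h/= scale0r addr0 subrr normr0 => /(_ _ e0); apply.
move=> /nbhs_ballP[d /= d0 dP]; exists d => // r x rd.
have [w [t [Lw ct xw]]] := reduce_cube x.
rewrite -(pg _ x Lw) -(pg _ (x + r *: v) Lw) addrAC xw.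
by apply: dP => //; rewrite /ball/= sub0r normrN.
Qed.

Lemma is_derive_line f x v (s : R) : derivable f (x + s *: v) v ->
  is_derive s (1 : R) (fun r => f (x + r *: v)) ('D_v f (x + s *: v)).
Proof.
move=> df.
have E : (fun h : R => h^-1 *: (((fun r => f (x + r *: v)) \o shift s) (h *: (1 : R)) - f (x + s *: v)))
   = (fun h : R => h^-1 *: ((f \o shift (x + s *: v)) (h *: v) - f (x + s *: v))).
  apply/funext => h /=; congr (_ *: (f _ - _)).
  by rewrite scaler1 scalerDl addrCA.
by apply: DeriveDef; rewrite /derivable /derive E.
Qed.

(** The difference quotients of f have mean 0 by translation invariance, and
    converge uniformly to D_v f by the mean value theorem and uniform continuity
    of D_v f. *)
Lemma mean_derive f v : continuous f -> rperiodic f ->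
  (forall x, derivable f x v) -> continuous (fun x => 'D_v f x) ->
  mean (fun x => 'D_v f x) = 0.
Proof.
move=> cf pf df cdf.
have pdf : rperiodic (fun x => 'D_v f x).
  move=> w x Lw; rewrite /derive.
  have -> : (fun h : R => h^-1 *: ((f \o shift (x + w)) (h *: v) - f (x + w))) =
            (fun h : R => h^-1 *: ((f \o shift x) (h *: v) - f x)).
    by apply/funext => h; rewrite /= addrA !(pf _ _ Lw).
  by [].
suff H e : 0 < e -> `|mean (fun x => 'D_v f x)| <= e.
  apply/eqP; rewrite -normr_le0 leNgt; apply/negP => m0.
  by have := H _ (divr_gt0 m0 (ltr0n _ 2)); lra.
move=> e0; have [d d0 dP] := uniform_continuity v cdf pdf e0.
pose s := d / 2; have s0 : 0 < s by rewrite divr_gt0.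
pose q x := s^-1 * (f (x + s *: v) - f x).
have cfs : continuous (fun x => f (x + s *: v)).
  apply: (continuous_fcomp _ cf) => x.
  exact: (@cvgD _ _ _ (nbhs x) _ id (fun=> s *: v) _ _ cvg_id (cvg_cst _)).
have cfsf := continuous_fB cfs cf.
have cq : continuous q by apply: continuous_fM => //; exact: continuous_fcst.
have mq : mean q = 0.
  by rewrite /q meanZ// meanB// mean_shift// subrr mulr0.
have qP x : `|'D_v f x - q x| <= e.
  have [c] := @MVT_closed R (fun r => 'D_v f (x + r *: v)) (fun r => f (x + r *: v)) 0 s (ltW s0)
     (fun r _ => is_derive_line (df _)).
  rewrite scale0r addr0 subr0 => /andP[c0 cs] E.
  have -> : q x = 'D_v f (x + c *: v).
    by rewrite /q E mulrC mulfK// gt_eqF.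
  by rewrite distrC; apply/ltW/dP; rewrite ger0_norm// (le_lt_trans cs)// /s; lra.
have cDq : continuous (fun x => 'D_v f x - q x) by exact: continuous_fB.
rewrite -[mean _]subr0 -mq -meanB// ler_norml; apply/andP; split.
  rewrite -[leLHS]mean_cst; apply: le_mean => //; first exact: continuous_fcst.
  by move=> x; have := qP x; rewrite ler_norml => /andP[].
rewrite -[leRHS]mean_cst; apply: le_mean => //; first exact: continuous_fcst.
by move=> x; have := qP x; rewrite ler_norml => /andP[].
Qed.

Lemma mean_by_parts f g v : continuous f -> continuous g -> rperiodic f -> rperiodic g ->
  (forall x, derivable f x v) -> (forall x, derivable g x v) ->
  continuous (fun x => 'D_v f x) -> continuous (fun x => 'D_v g x) ->
  mean (fun x => 'D_v f x * g x) = - mean (fun x => f x * 'D_v g x).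
Proof.
move=> cf cg pf pg df dg cdf cdg.
have E : (fun x => 'D_v (f * g) x) = (fun x => f x * 'D_v g x + 'D_v f x * g x).
  by apply/funext => x; rewrite deriveM//= [X in _ + X]mulrC.
have c1 := continuous_fM cf cdg; have c2 := continuous_fM cdf cg.
have : mean (fun x => 'D_v (f * g) x) = 0.
  apply: mean_derive.
  - exact: continuous_fM.
  - by move=> w x Lw; rewrite /GRing.mul/= pf// pg.
  - by move=> x; apply: derivableM; [exact: df|exact: dg].
  - by rewrite E; exact: continuous_fD.
by rewrite E (meanD c1 c2) => /eqP; rewrite addrC addr_eq0 => /eqP.
Qed.

End Mean.

(** * Calculus of smooth complex functions *)
Section ReIm.
Context {R : realType}.
Implicit Types x y : R[i].

Lemma cReD x y : complex.Re (x + y) = complex.Re x + complex.Re y.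
Proof. by case: x y => [a b] [c d]. Qed.
Lemma cImD x y : complex.Im (x + y) = complex.Im x + complex.Im y.
Proof. by case: x y => [a b] [c d]. Qed.
Lemma cReN x : complex.Re (- x) = - complex.Re x.
Proof. by case: x. Qed.
Lemma cImN x : complex.Im (- x) = - complex.Im x.
Proof. by case: x. Qed.
Lemma cReM x y : complex.Re (x * y) = complex.Re x * complex.Re y - complex.Im x * complex.Im y.
Proof. by case: x y => [a b] [c d]. Qed.
Lemma cImM x y : complex.Im (x * y) = complex.Re x * complex.Im y + complex.Im x * complex.Re y.
Proof. by case: x y => [a b] [c d]. Qed.
Lemma cReJ x : complex.Re x^* = complex.Re x.
Proof. by case: x. Qed.
Lemma cImJ x : complex.Im x^* = - complex.Im x.
Proof. by case: x. Qed.
Lemma complex_ext x y : complex.Re x = complex.Re y -> complex.Im x = complex.Im y -> x = y.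
Proof. by case: x y => [a b] [c d] /= -> ->. Qed.

End ReIm.

Section Smooth.
Context {R : realType} {n : nat}.
Implicit Types (f g : 'rV[R]_n -> R) (x v : 'rV[R]_n) (a : R) (j : 'I_n).

Lemma smooth_continuous f : smooth f -> continuous f.
Proof. by move=> /(_ 0%N)[]. Qed.

Lemma smooth_derivable f j x : smooth f -> derivable f x (delta_mx ord0 j).
Proof. by move=> /(_ 1%N)[_ /(_ j)[+ _]]; exact. Qed.

Lemma smooth_partial f j : smooth f -> smooth (partial j f).
Proof. by move=> sf k; have [_ /(_ j)[_]] := sf k.+1. Qed.

Lemma partialD f g j : (forall x, derivable f x (delta_mx ord0 j)) ->
  (forall x, derivable g x (delta_mx ord0 j)) ->
  partial j (fun x => f x + g x) = (fun x => partial j f x + partial j g x).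
Proof. by move=> df dg; apply/funext => x; rewrite /partial -deriveD. Qed.

Lemma partialZ f a j : (forall x, derivable f x (delta_mx ord0 j)) ->
  partial j (fun x => a * f x) = (fun x => a * partial j f x).
Proof. by move=> df; apply/funext => x; rewrite /partial; exact: (deriveZ a (df x)). Qed.

Lemma CkD k f g : Ck k f -> Ck k g -> Ck k (fun x => f x + g x).
Proof.
elim: k f g => [|k IH] f g [cf df] [cg dg]; first by split => //; exact: continuous_fD.
split; first exact: continuous_fD.
move=> j; have [dfj cfj] := df j; have [dgj cgj] := dg j; split.
  by move=> x; exact: derivableD.
by rewrite partialD//; exact: IH.
Qed.

Lemma CkZ k a f : Ck k f -> Ck k (fun x => a * f x).
Proof.
have cZ g : continuous g -> continuous (fun x => a * g x).
  by apply: continuous_fM; exact: continuous_fcst.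
elim: k f => [|k IH] f [cf df]; first by split => //; exact: cZ.
split; first exact: cZ.
move=> j; have [dfj cfj] := df j; split.
  by move=> x; apply: derivableZ; exact: dfj.
by rewrite partialZ//; exact: IH.
Qed.

Lemma smoothD f g : smooth f -> smooth g -> smooth (fun x => f x + g x).
Proof. by move=> sf sg k; exact: CkD. Qed.

Lemma smoothZ a f : smooth f -> smooth (fun x => a * f x).
Proof. by move=> sf k; exact: CkZ. Qed.

Lemma smoothN f : smooth f -> smooth (fun x => - f x).
Proof. by move=> /(smoothZ (-1)); under eq_fun do rewrite mulN1r. Qed.

Lemma smooth0 : smooth (fun _ : 'rV[R]_n => 0 : R).
Proof.
move=> k; elim: k => [|k IH]; first by split => //; exact: continuous_fcst.
split; first exact: continuous_fcst.
move=> j; split; first by move=> x; exact: derivable_cst.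
by rewrite (_ : partial j _ = fun=> 0)//; apply/funext => x; rewrite /partial derive_cst.
Qed.

Lemma is_derive_of_line f v x (df : R) :
  is_derive (0 : R) (1 : R) (fun r => f (x + r *: v)) df -> is_derive x v f df.
Proof.
have E : (fun h : R => h^-1 *: (((fun r => f (x + r *: v)) \o shift 0) (h *: (1 : R)) - f (x + 0 *: v)))
   = (fun h : R => h^-1 *: ((f \o shift x) (h *: v) - f x)).
  apply/funext => h /=; congr (_ *: (f _ - f _)).
    by rewrite scaler1 addr0 addrC.
  by rewrite scale0r addr0.
by move=> [d1 d2]; apply: DeriveDef; move: d1 d2; rewrite /derivable /derive E.
Qed.

Lemma is_derive_affine (a b : R) :
  is_derive (0 : R) (1 : R) (fun r => a + r * b) b.
Proof.
have -> : (fun r : R => a + r * b) = cst a + (b \*: id).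
  by apply/funext => r; rewrite /= mulrC.
have -> : b = 0 + b *: 1 :> R by rewrite add0r scaler1.
by rewrite {1}add0r {1}scaler1; exact: is_deriveD.
Qed.

(** Trigonometric functions of a linear form; stated for an abstract linear form
    to avoid unfolding the pairing with the dual lattice. *)
Section linear_phase.
Context (phi : 'rV[R]_n -> R) (cphi : continuous phi)
  (phiD : forall x y, phi (x + y) = phi x + phi y)
  (phiZ : forall a x, phi (a *: x) = a * phi x).

Lemma is_derive_cos_phase x v :
  is_derive x v (fun y => cos (phi y)) (- phi v * sin (phi x)).
Proof.
apply: is_derive_of_line.
under eq_fun do rewrite phiD phiZ.
have d1 := is_derive_affine (phi x) (phi v).
have d2 := @is_derive_cos R (phi x + 0 * phi v).
have := @is_derive1_comp R cos (fun r => phi x + r * phi v) 0 _ _ d2 d1.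
by rewrite mul0r addr0 => H; rewrite mulNr mulrC -mulNr.
Qed.

Lemma is_derive_sin_phase x v :
  is_derive x v (fun y => sin (phi y)) (phi v * cos (phi x)).
Proof.
apply: is_derive_of_line.
under eq_fun do rewrite phiD phiZ.
have d1 := is_derive_affine (phi x) (phi v).
have d2 := @is_derive_sin R (phi x + 0 * phi v).
have := @is_derive1_comp R sin (fun r => phi x + r * phi v) 0 _ _ d2 d1.
by rewrite mul0r addr0 mulrC.
Qed.

Lemma partial_cos_phase j :
  partial j (fun y => cos (phi y)) = (fun x => - phi (delta_mx ord0 j) * sin (phi x)).
Proof. by apply/funext => x; case: (is_derive_cos_phase x (delta_mx ord0 j)). Qed.

Lemma partial_sin_phase j :
  partial j (fun y => sin (phi y)) = (fun x => phi (delta_mx ord0 j) * cos (phi x)).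
Proof. by apply/funext => x; case: (is_derive_sin_phase x (delta_mx ord0 j)). Qed.

Lemma smooth_cos_sin_phase :
  smooth (fun y => cos (phi y)) /\ smooth (fun y => sin (phi y)).
Proof.
have cc : continuous (fun y => cos (phi y)) by exact: (continuous_fcomp cphi (@continuous_cos R)).
have cs : continuous (fun y => sin (phi y)) by exact: (continuous_fcomp cphi (@continuous_sin R)).
suff H k : Ck k (fun y => cos (phi y)) /\ Ck k (fun y => sin (phi y)).
  by split => k; have [] := H k.
elim: k => [|k [IHc IHs]]; first by split.
split; split => // j; split.
- by move=> x; case: (is_derive_cos_phase x (delta_mx ord0 j)).
- by rewrite partial_cos_phase; exact: CkZ.
- by move=> x; case: (is_derive_sin_phase x (delta_mx ord0 j)).
- by rewrite partial_sin_phase; exact: CkZ.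
Qed.

End linear_phase.

End Smooth.

Section ComplexSmooth.
Context {R : realType} {n : nat}.
Implicit Types (f g : 'rV[R]_n -> R[i]) (x v : 'rV[R]_n) (c : R[i]) (j : 'I_n).

Lemma csmoothD f g : csmooth f -> csmooth g -> csmooth (fun x => f x + g x).
Proof.
move=> [f1 f2] [g1 g2]; split.
  by under eq_fun do rewrite cReD; exact: smoothD.
by under eq_fun do rewrite cImD; exact: smoothD.
Qed.

Lemma csmoothZ c f : csmooth f -> csmooth (fun x => c * f x).
Proof.
move=> [f1 f2]; split.
  under eq_fun do rewrite cReM; apply: smoothD; first exact: smoothZ.
  by apply: smoothN; exact: smoothZ.
by under eq_fun do rewrite cImM; apply: smoothD; exact: smoothZ.
Qed.

Lemma csmooth0 : csmooth (fun _ : 'rV[R]_n => 0 : R[i]).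
Proof. by split; exact: smooth0. Qed.

Lemma csmooth_sum (I : Type) (r : seq I) (P : pred I) (F : I -> 'rV[R]_n -> R[i]) :
  (forall i, P i -> csmooth (F i)) -> csmooth (fun x => \sum_(i <- r | P i) F i x).
Proof.
move=> sF; elim: r => [|i r IH].
  by under eq_fun do rewrite big_nil; exact: csmooth0.
under eq_fun do rewrite big_cons.
by case Pi: (P i) => //; apply: csmoothD => //; exact: sF.
Qed.

Lemma csmooth_conj f : csmooth f -> csmooth (fun x => (f x)^*).
Proof.
move=> [f1 f2]; split; first by under eq_fun do rewrite cReJ.
by under eq_fun do rewrite cImJ; exact: smoothN.
Qed.

Lemma csmooth_cpartial j f : csmooth f -> csmooth (cpartial j f).
Proof. by move=> [f1 f2]; split; exact: smooth_partial. Qed.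

Lemma cpartial0 j : cpartial j (fun _ : 'rV[R]_n => 0 : R[i]) = fun=> 0.
Proof.
by apply/funext => x; apply: complex_ext; rewrite /= /partial derive_cst.
Qed.

Lemma cpartial_conj j f : csmooth f ->
  cpartial j (fun x => (f x)^*) = (fun x => (cpartial j f x)^*).
Proof.
move=> [f1 f2]; apply/funext => x; apply: complex_ext; rewrite ?cReJ ?cImJ /=.
  by under [X in partial j X]eq_fun do rewrite cReJ.
under [X in partial j X]eq_fun do rewrite cImJ -mulN1r.
by rewrite partialZ ?mulN1r// => y; exact: smooth_derivable.
Qed.

End ComplexSmooth.

(** * The complex mean and the Fourier coefficients *)
Section ComplexMean.
Context {R : realType} {n : nat} (B : 'M[R]_n) (Bu : B \in unitmx).
Implicit Types (f g : 'rV[R]_n -> R[i]) (x v : 'rV[R]_n) (c : R[i]) (j : 'I_n)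
  (k l : 'rV[int]_n).
Local Notation periodicB := (@Defs.periodic R n (Zspan B)).

Definition ccontinuous f :=
  continuous (fun x => complex.Re (f x)) /\ continuous (fun x => complex.Im (f x)).

Lemma ccontinuousD f g : ccontinuous f -> ccontinuous g ->
  ccontinuous (fun x => f x + g x).
Proof.
move=> [f1 f2] [g1 g2]; split.
  by under eq_fun do rewrite cReD; exact: continuous_fD.
by under eq_fun do rewrite cImD; exact: continuous_fD.
Qed.

Lemma ccontinuousM f g : ccontinuous f -> ccontinuous g ->
  ccontinuous (fun x => f x * g x).
Proof.
move=> [f1 f2] [g1 g2]; split.
  by under eq_fun do rewrite cReM; apply: continuous_fB; exact: continuous_fM.
by under eq_fun do rewrite cImM; apply: continuous_fD; exact: continuous_fM.
Qed.

Lemma ccontinuous_cst c : ccontinuous (fun=> c).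
Proof. by split; exact: continuous_fcst. Qed.

Lemma ccontinuousN f : ccontinuous f -> ccontinuous (fun x => - f x).
Proof.
by move=> cf; under eq_fun do rewrite -mulN1r; apply: ccontinuousM => //; exact: ccontinuous_cst.
Qed.

Lemma ccontinuous_sum (I : Type) (r : seq I) (P : pred I) (F : I -> 'rV[R]_n -> R[i]) :
  (forall i, P i -> ccontinuous (F i)) ->
  ccontinuous (fun x => \sum_(i <- r | P i) F i x).
Proof.
move=> cF; elim: r => [|i r IH].
  by under eq_fun do rewrite big_nil; exact: ccontinuous_cst.
under eq_fun do rewrite big_cons.
by case Pi: (P i) => //; apply: ccontinuousD => //; exact: cF.
Qed.

Lemma ccontinuous_conj f : ccontinuous f -> ccontinuous (fun x => (f x)^*).
Proof.
move=> [f1 f2]; split; first by under eq_fun do rewrite cReJ.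
by under eq_fun do rewrite cImJ; exact: continuous_fN.
Qed.

Lemma csmooth_ccontinuous f : csmooth f -> ccontinuous f.
Proof. by move=> [f1 f2]; split; exact: smooth_continuous. Qed.

Definition cmean f : R[i] :=
  mean B (fun x => complex.Re (f x)) +i* mean B (fun x => complex.Im (f x)).

Lemma cmeanD f g : ccontinuous f -> ccontinuous g ->
  cmean (fun x => f x + g x) = cmean f + cmean g.
Proof.
move=> [f1 f2] [g1 g2]; apply: complex_ext => /=; rewrite -meanD//; congr mean;
  by apply/funext => x; rewrite ?cReD ?cImD.
Qed.

Lemma cmeanZ c f : ccontinuous f -> cmean (fun x => c * f x) = c * cmean f.
Proof.
move=> [f1 f2]; have cZ a (h : 'rV[R]_n -> R) : continuous h -> continuous (fun x => a * h x).
  by apply: continuous_fM; exact: continuous_fcst.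
apply: complex_ext; rewrite ?cReM ?cImM /=.
  under [X in mean B X]eq_fun do rewrite cReM.
  by rewrite meanB ?meanZ//; exact: cZ.
under [X in mean B X]eq_fun do rewrite cImM.
by rewrite meanD ?meanZ//; exact: cZ.
Qed.

Lemma cmean_cst c : cmean (fun=> c) = c.
Proof. by rewrite /cmean !mean_cst; case: c. Qed.

Lemma cmeanN f : ccontinuous f -> cmean (fun x => - f x) = - cmean f.
Proof.
move=> cf; rewrite -mulN1r -cmeanZ//; congr cmean.
by apply/funext => x; rewrite mulN1r.
Qed.

Lemma cmean_sum (I : Type) (r : seq I) (P : pred I) (F : I -> 'rV[R]_n -> R[i]) :
  (forall i, P i -> ccontinuous (F i)) ->
  cmean (fun x => \sum_(i <- r | P i) F i x) = \sum_(i <- r | P i) cmean (F i).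
Proof.
move=> cF; elim: r => [|i r IH].
  by under eq_fun do rewrite big_nil; rewrite big_nil cmean_cst.
under eq_fun do rewrite big_cons; rewrite big_cons.
case Pi: (P i) => //; rewrite cmeanD ?IH//; first exact: cF.
exact: ccontinuous_sum.
Qed.

Lemma periodic_sum (I : Type) (r : seq I) (P : pred I) (F : I -> 'rV[R]_n -> R[i]) :
  (forall i, P i -> periodicB (F i)) ->
  periodicB (fun x => \sum_(i <- r | P i) F i x).
Proof. by move=> pF v x Lv; apply: eq_bigr => i Pi; rewrite pF. Qed.

Lemma rperiodic_Re f : periodicB f -> rperiodic B (fun x => complex.Re (f x)).
Proof. by move=> pf v x Lv; rewrite pf. Qed.

Lemma rperiodic_Im f : periodicB f -> rperiodic B (fun x => complex.Im (f x)).
Proof. by move=> pf v x Lv; rewrite pf. Qed.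

Lemma periodic_cpartial j f : periodicB f -> periodicB (cpartial j f).
Proof.
move=> pf; have H (h : 'rV[R]_n -> R) : rperiodic B h -> rperiodic B (partial j h).
  move=> ph v x Lv; rewrite /partial /derive.
  have -> : (fun r : R => r^-1 *: ((h \o shift (x + v)) (r *: delta_mx ord0 j) - h (x + v))) =
            (fun r : R => r^-1 *: ((h \o shift x) (r *: delta_mx ord0 j) - h x)).
    by apply/funext => r; rewrite /= addrA !(ph _ _ Lv).
  by [].
by move=> v x Lv; rewrite /cpartial !H//; [exact: rperiodic_Im|exact: rperiodic_Re].
Qed.

Lemma cmean_by_parts j f g : csmooth f -> csmooth g -> periodicB f -> periodicB g ->
  cmean (fun x => cpartial j f x * g x) = - cmean (fun x => f x * cpartial j g x).
Proof.
move=> sf sg pf pg; have [f1 f2] := sf; have [g1 g2] := sg.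
have H (u w : 'rV[R]_n -> R) : smooth u -> smooth w -> rperiodic B u -> rperiodic B w ->
    mean B (fun x => partial j u x * w x) = - mean B (fun x => u x * partial j w x).
  move=> su sw pu pw; apply: mean_by_parts => //; try exact: smooth_continuous;
    try by move=> x; exact: smooth_derivable.
  - exact: smooth_continuous (smooth_partial j su).
  - exact: smooth_continuous (smooth_partial j sw).
have c1 := smooth_continuous f1; have c2 := smooth_continuous f2.
have c3 := smooth_continuous g1; have c4 := smooth_continuous g2.
have d1 := smooth_continuous (smooth_partial j f1).
have d2 := smooth_continuous (smooth_partial j f2).
have d3 := smooth_continuous (smooth_partial j g1).
have d4 := smooth_continuous (smooth_partial j g2).
have p1 := rperiodic_Re pf; have p2 := rperiodic_Im pf.
have p3 := rperiodic_Re pg; have p4 := rperiodic_Im pg.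
apply: complex_ext; rewrite ?cReN ?cImN /cmean [LHS]/= [in RHS]/=.
  under [X in mean B X = _]eq_fun do rewrite cReM.
  under [X in _ = - mean B X]eq_fun do rewrite cReM.
  rewrite (meanB B (continuous_fM d1 c3) (continuous_fM d2 c4)).
  rewrite (meanB B (continuous_fM c1 d3) (continuous_fM c2 d4)).
  by rewrite !H// opprB opprK addrC.
under [X in mean B X = _]eq_fun do rewrite cImM.
under [X in _ = - mean B X]eq_fun do rewrite cImM.
rewrite (meanD B (continuous_fM d1 c4) (continuous_fM d2 c3)).
rewrite (meanD B (continuous_fM c1 d4) (continuous_fM c2 d3)).
by rewrite !H// opprD.
Qed.

(** Strict positivity of the mean, applied to the sum of the |F_i|^2. *)
Lemma cmean_norm_eq0 (I : finType) (F : I -> 'rV[R]_n -> R[i]) :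
  (forall i, ccontinuous (F i)) -> (forall i, periodicB (F i)) ->
  cmean (fun x => \sum_i F i x * (F i x)^*) = 0 -> forall i x, F i x = 0.
Proof.
move=> cF pF /(congr1 (@complex.Re R)) /=.
pose h x : R := \sum_i (complex.Re (F i x) ^+ 2 + complex.Im (F i x) ^+ 2).
have -> : (fun x => complex.Re (\sum_i F i x * (F i x)^*)) = h.
  apply/funext => x; rewrite /h; elim/big_rec2 : _ => // i y z _ <-.
  by rewrite cReD cReM cReJ cImJ mulrN opprK !expr2.
move=> mh; have h0 : forall x, h x = 0.
  apply: (mean_eq0 Bu) mh => //.
  - apply: continuous_fsum => i; have [c1 c2] := cF i.
    by apply: continuous_fD; exact: continuous_fX.
  - by move=> v x Lv; apply: eq_bigr => i _; rewrite pF.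
  - by move=> x; apply: sumr_ge0 => i _; rewrite addr_ge0// sqr_ge0.
move=> i x; have /eqP := h0 x; rewrite psumr_eq0; last first.
  by move=> l _; rewrite addr_ge0// sqr_ge0.
move=> /allP/(_ i (mem_index_enum _)) /=.
rewrite paddr_eq0 ?sqr_ge0// !sqrf_eq0 => /andP[/eqP r0 /eqP i0].
exact: complex_ext.
Qed.

End ComplexMean.

Section Characters.
Context {R : realType} {n : nat} (B : 'M[R]_n) (Bu : B \in unitmx).
Implicit Types (f g : 'rV[R]_n -> R[i]) (x v : 'rV[R]_n) (c : R[i]) (j : 'I_n)
  (k l : 'rV[int]_n).
Local Notation periodicB := (@Defs.periodic R n (Zspan B)).

(** 2 pi times the pairing of x with the dual lattice vector of coordinates k. *)
Definition dual_phase k x : R := phase k (x *m invmx B).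
Definition echar k x : R[i] := cos (dual_phase k x) +i* sin (dual_phase k x).
Definition freq k j : R := dual_phase k (delta_mx ord0 j).

Lemma phaseZr k (a : R) (t : 'rV[R]_n) : phase k (a *: t) = a * phase k t.
Proof.
rewrite /phase [RHS]mulrCA [in RHS]mulr_sumr; congr (_ * _); apply: eq_bigr => i _.
by rewrite mxE mulrCA.
Qed.

Lemma dual_phaseD k x y : dual_phase k (x + y) = dual_phase k x + dual_phase k y.
Proof. by rewrite /dual_phase mulmxDl phaseDr. Qed.

Lemma dual_phaseZ k a x : dual_phase k (a *: x) = a * dual_phase k x.
Proof. by rewrite /dual_phase -scalemxAl phaseZr. Qed.

Lemma continuous_dual_phase k : continuous (dual_phase k).
Proof.
exact: (continuous_fcomp (@continuous_mulmxr R 1 n n (invmx B)) (@continuous_phase R n k)).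
Qed.

Lemma dual_phase_freq k x : dual_phase k x = \sum_j x ord0 j * freq k j.
Proof.
rewrite [in LHS](row_sum_delta x).
elim/big_rec2 : _ => [|j y z _ <-]; first by rewrite -(scale0r 0) dual_phaseZ mul0r.
by rewrite dual_phaseD dual_phaseZ.
Qed.

Lemma csmooth_echar k : csmooth (echar k).
Proof.
have [c s] := smooth_cos_sin_phase (@continuous_dual_phase k) (dual_phaseD k) (dual_phaseZ k).
by split.
Qed.

Lemma periodic_echar k : periodicB (echar k).
Proof.
move=> v x [m ->]; have -> : \sum_i (m i)%:~R *: row i B = (\row_i (m i)%:~R) *m B.
  by rewrite mulmx_sum_row; apply: eq_bigr => i _; rewrite mxE.
by rewrite /echar dual_phaseD /dual_phase mulmxK// phase_int cosD2piz sinD2piz.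
Qed.

Lemma cpartial_echar j k x : cpartial j (echar k) x = (0 +i* freq k j) * echar k x.
Proof.
rewrite /cpartial /echar /=.
rewrite (partial_cos_phase (dual_phaseD k) (dual_phaseZ k)).
rewrite (partial_sin_phase (dual_phaseD k) (dual_phaseZ k)).
by apply: complex_ext => /=; rewrite -/(freq k j); ring.
Qed.

Lemma echarD k l x : echar k x * echar l x = echar (k + l) x.
Proof.
by rewrite /echar /dual_phase phaseDl cosD sinD; apply: complex_ext => /=; ring.
Qed.

Lemma echar0 x : echar 0 x = 1.
Proof. by rewrite /echar /dual_phase phase0l cos0 sin0. Qed.

Lemma echarN k x : echar (- k) x = (echar k x)^*.
Proof. by rewrite /echar /dual_phase phaseNl cosN sinN. Qed.

(** The phase is linear, so it vanishes identically, and its value at the i-th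
    basis vector is 2 pi k_i. *)
Lemma freq_eq0 k : (forall j, freq k j = 0) -> k = 0.
Proof.
move=> k0; apply/rowP => i; rewrite mxE.
have : dual_phase k (delta_mx ord0 i *m B) = 0.
  by rewrite dual_phase_freq big1// => j _; rewrite k0 mulr0.
rewrite /dual_phase mulmxK// /phase (bigD1 i)//= big1 ?addr0; last first.
  by move=> j ji; rewrite mxE (negPf ji) andbF mulr0.
rewrite mxE !eqxx mulr1 => /eqP; rewrite !mulf_eq0 pnatr_eq0/= gt_eqF ?pi_gt0//=.
by rewrite intr_eq0 => /eqP.
Qed.

Definition fcoef f k : R[i] := cmean B (fun x => f x * echar (- k) x).

Lemma ccontinuous_echar k : ccontinuous (echar k).
Proof. exact/csmooth_ccontinuous/csmooth_echar. Qed.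

Lemma ccontinuous_mul_echar f k : ccontinuous f -> ccontinuous (fun x => f x * echar k x).
Proof. by move=> cf; apply: ccontinuousM => //; exact: ccontinuous_echar. Qed.

(** For k <> 0, some derivative of the character is a nonzero multiple of it and has
    mean 0. *)
Lemma cmean_echar k : cmean B (echar k) = (k == 0)%:R.
Proof.
case: eqVneq => [->|k0] /=.
  by rewrite -[RHS](cmean_cst B); congr (cmean B _); apply/funext => x; exact: echar0.
have [j kj] : exists j, freq k j != 0.
  apply/existsP; rewrite -[X in is_true X]negbK; apply: contra k0.
  by rewrite negb_exists => /forallP H; apply/eqP/freq_eq0 => j; apply/eqP; rewrite -[_ == _]negbK H.
have H1 : csmooth (fun _ : 'rV[R]_n => 1 : R[i]).
  by rewrite (_ : (fun _ => 1) = echar 0); [exact: csmooth_echar|apply/funext => x; rewrite echar0].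
have := cmean_by_parts Bu j (csmooth_echar k) H1 (periodic_echar k) (fun _ _ _ => erefl).
under [X in _ = - cmean B X -> _]eq_fun => x.
  have -> : cpartial j (fun _ : 'rV[R]_n => 1 : R[i]) x = 0.
    by apply: complex_ext; rewrite /= /partial derive_cst.
  rewrite mulr0; over.
rewrite cmean_cst oppr0; under eq_fun do rewrite mulr1 cpartial_echar.
rewrite cmeanZ; last exact: ccontinuous_echar.
move/eqP; rewrite mulf_eq0 => /orP[|/eqP//].
by move=> /eqP/(congr1 (@complex.Im R))/= /eqP; rewrite (negPf kj).
Qed.

Lemma fcoefD f g k : ccontinuous f -> ccontinuous g ->
  fcoef (fun x => f x + g x) k = fcoef f k + fcoef g k.
Proof.
move=> cf cg; rewrite /fcoef -cmeanD; try exact: ccontinuous_mul_echar.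
by under eq_fun do rewrite mulrDl.
Qed.

Lemma fcoefZ c f k : ccontinuous f -> fcoef (fun x => c * f x) k = c * fcoef f k.
Proof.
move=> cf; rewrite /fcoef -cmeanZ; try exact: ccontinuous_mul_echar.
by under eq_fun do rewrite -mulrA.
Qed.

Lemma fcoef_sum (I : Type) (r : seq I) (P : pred I) (F : I -> 'rV[R]_n -> R[i]) k :
  (forall i, P i -> ccontinuous (F i)) ->
  fcoef (fun x => \sum_(i <- r | P i) F i x) k = \sum_(i <- r | P i) fcoef (F i) k.
Proof.
move=> cF; rewrite /fcoef -cmean_sum; last by move=> i Pi; apply: ccontinuous_mul_echar; exact: cF.
by under eq_fun do rewrite mulr_suml.
Qed.

Lemma fcoef_echar k l : fcoef (echar l) k = (l == k)%:R.
Proof.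
rewrite /fcoef; under eq_fun do rewrite echarD.
by rewrite cmean_echar subr_eq0.
Qed.

Lemma fcoef_cpartial j f k : csmooth f -> periodicB f ->
  fcoef (cpartial j f) k = (0 +i* freq k j) * fcoef f k.
Proof.
move=> sf pf; rewrite /fcoef cmean_by_parts//; [|exact: csmooth_echar|exact: periodic_echar].
rewrite -cmeanZ; last by apply: ccontinuous_mul_echar; exact: csmooth_ccontinuous.
rewrite -cmeanN; last first.
  apply: ccontinuousM; first exact: csmooth_ccontinuous.
  by apply: csmooth_ccontinuous; apply: csmooth_cpartial; exact: csmooth_echar.
congr (cmean B _); apply/funext => x; rewrite cpartial_echar.
have -> : freq (- k) j = - freq k j by rewrite /freq /dual_phase phaseNl.
have -> : 0 +i* - freq k j = - (0 +i* freq k j) by apply: complex_ext; rewrite ?cReN ?cImN /= ?oppr0.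
by ring.
Qed.

(** The coefficients at k and - k together give the cosine and sine integrals of
    the real and of the imaginary part separately. *)
Lemma fcoef_inj f : ccontinuous f -> periodicB f -> (forall k, fcoef f k = 0) ->
  forall x, f x = 0.
Proof.
move=> [cu cw] pf f0.
pose u x := complex.Re (f x); pose w x := complex.Im (f x).
pose C k x := cos (dual_phase k x); pose S k x := sin (dual_phase k x).
have cC k : continuous (C k) by have [] := ccontinuous_echar k.
have cS k : continuous (S k) by have [] := ccontinuous_echar k.
have cuC k : continuous (fun x => u x * C k x) by exact: continuous_fM.
have cuS k : continuous (fun x => u x * S k x) by exact: continuous_fM.
have cwC k : continuous (fun x => w x * C k x) by exact: continuous_fM.
have cwS k : continuous (fun x => w x * S k x) by exact: continuous_fM.
have E k : mean B (fun x => u x * C k x) + mean B (fun x => w x * S k x) = 0 /\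
           mean B (fun x => w x * C k x) - mean B (fun x => u x * S k x) = 0.
  have H := f0 k; rewrite /fcoef in H; split.
    rewrite -meanD//; have := congr1 (@complex.Re R) H; rewrite /= => <-.
    congr mean; apply/funext => x.
    by rewrite echarN cReM cReJ cImJ /u /w /C /S /=; ring.
  rewrite -meanB//; have := congr1 (@complex.Im R) H; rewrite /= => <-.
  congr mean; apply/funext => x.
  by rewrite echarN cImM cReJ cImJ /u /w /C /S /=; ring.
have CN k x : C (- k) x = C k x by rewrite /C /dual_phase phaseNl cosN.
have SN k x : S (- k) x = - S k x by rewrite /S /dual_phase phaseNl sinN.
have E' k : mean B (fun x => u x * C k x) - mean B (fun x => w x * S k x) = 0 /\
           mean B (fun x => w x * C k x) + mean B (fun x => u x * S k x) = 0.
  have CE (h : 'rV[R]_n -> R) : (fun x => h x * C (- k) x) = (fun x => h x * C k x).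
    by apply/funext => x; rewrite CN.
  have SE (h : 'rV[R]_n -> R) : (fun x => h x * S (- k) x) = (fun x => - (h x * S k x)).
    by apply/funext => x; rewrite SN mulrN.
  by have [] := E (- k); rewrite !CE !SE !meanN// opprK.
have unull (h : 'rV[R]_n -> R) : continuous h -> rperiodic B h ->
    (forall k, mean B (fun x => h x * C k x) = 0) ->
    (forall k, mean B (fun x => h x * S k x) = 0) -> forall x, h x = 0.
  move=> ch ph hC hS x; rewrite -[x](mulmxKV Bu).
  apply: (@fourier_unique R n (fun t => h (t *m B))).
  - exact: continuous_coords.
  - exact: Zperiodic_coords.
  - move=> k; split; [rewrite -[RHS](hC k)|rewrite -[RHS](hS k)];
    by apply: eq_cube_integral => t _; rewrite /C /S /dual_phase mulmxK.
move=> x; apply: complex_ext.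
  apply: (unull u) => //; first exact: rperiodic_Re.
    by move=> k; have [E1 _] := E k; have [E2 _] := E' k; lra.
  by move=> k; have [_ E1] := E k; have [_ E2] := E' k; lra.
apply: (unull w) => //; first exact: rperiodic_Im.
  by move=> k; have [_ E1] := E k; have [_ E2] := E' k; lra.
by move=> k; have [E1 _] := E k; have [E2 _] := E' k; lra.
Qed.

End Characters.

(** * The codifferential and the symbol of the operator *)
Section Codifferential.
Context {R : realType} {n : nat} (L : set 'rV[R]_n) (hL : is_lattice L).
Implicit Types (w e z : dform R n) (I J : {set 'I_n}) (k : 'rV[int]_n).
Local Notation B := (lattice_basis L).

Lemma lattice_basisP : B \in unitmx /\ L = Zspan B.
Proof. by have [B0 HB] := hL; exact: (xgetPex 1%:M (ex_intro _ B0 HB)). Qed.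

Let Bu : B \in unitmx := lattice_basisP.1.
Let LE : L = Zspan B := lattice_basisP.2.

Lemma Omega_all_periodic w I : Omega_all L w -> Defs.periodic (Zspan B) (w I).
Proof. by move=> Ow; rewrite -LE; exact: (Ow I).2. Qed.

(** The codifferential in coordinates. *)
Definition coform e : dform R n := fun I x =>
  - \sum_(j | j \notin I) wsign (j |: I) j * cpartial j (e (j |: I)) x.

Lemma extdE w J x : extd w J x = \sum_(j in J) wsign J j * cpartial j (w (J :\ j)) x.
Proof. by []. Qed.

Lemma Omega_all_extd w : Omega_all L w -> Omega_all L (extd w).
Proof.
move=> Ow J; split.
  apply: csmooth_sum => j _; apply: csmoothZ; apply: csmooth_cpartial.
  exact: (Ow _).1.
rewrite LE; apply: periodic_sum => j _ v x Lv; congr (_ * _).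
by apply: (periodic_cpartial j (Omega_all_periodic _ Ow)).
Qed.

Lemma coformE e : coform e = fun I x => \sum_(j | j \notin I) (- wsign (j |: I) j) * cpartial j (e (j |: I)) x.
Proof.
by apply/funext => I; apply/funext => x; rewrite /coform -sumrN; apply: eq_bigr => j _; rewrite mulNr.
Qed.

Lemma Omega_all_coform e : Omega_all L e -> Omega_all L (coform e).
Proof.
move=> Oe I; rewrite coformE; split.
  apply: csmooth_sum => j _; apply: csmoothZ; apply: csmooth_cpartial.
  exact: (Oe _).1.
rewrite LE; apply: periodic_sum => j _ v x Lv; congr (_ * _).
by apply: (periodic_cpartial j (Omega_all_periodic _ Oe)).
Qed.

Lemma L2_innerE w e : L2_inner L w e = (`|\det B|)%:C * cmean B (pointwise_inner w e).
Proof.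
rewrite /L2_inner /torus_integral /cmean /mean; apply: complex_ext; rewrite /=.
  by rewrite mul0r subr0.
by rewrite mul0r addr0.
Qed.

Lemma conj_wsign J j : (wsign J j)^* = wsign J j :> R[i].
Proof. by rewrite /wsign rmorphXn rmorphN rmorph1. Qed.

Lemma csmooth_pointwise_continuous w e I J : Omega_all L w -> Omega_all L e ->
  ccontinuous (fun x => w I x * (e J x)^*).
Proof.
move=> Ow Oe; apply: ccontinuousM; first exact: csmooth_ccontinuous (Ow I).1.
by apply: ccontinuous_conj; exact: csmooth_ccontinuous (Oe J).1.
Qed.

(** Integrate each term by parts, then index the sum by I = J minus j instead
    of J. *)
Lemma L2_adjoint w e : Omega_all L w -> Omega_all L e ->
  L2_inner L (extd w) e = L2_inner L w (coform e).
Proof.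
move=> Ow Oe; rewrite !L2_innerE; congr (_ * _).
have sw I := (Ow I).1; have se I := (Oe I).1.
have pw I := Omega_all_periodic I Ow; have pe I := Omega_all_periodic I Oe.
have cd J I j : ccontinuous (fun x => cpartial j (w I) x * (e J x)^*).
  apply: ccontinuousM; first by apply: csmooth_ccontinuous; exact: csmooth_cpartial.
  by apply: ccontinuous_conj; exact: csmooth_ccontinuous.
have cd' J I j : ccontinuous (fun x => w I x * (cpartial j (e J) x)^*).
  apply: ccontinuousM; first exact: csmooth_ccontinuous.
  by apply: ccontinuous_conj; apply: csmooth_ccontinuous; exact: csmooth_cpartial.
have cZ a (f : 'rV[R]_n -> R[i]) : ccontinuous f -> ccontinuous (fun x => a * f x).
  by apply: ccontinuousM; exact: ccontinuous_cst.
transitivity (\sum_(J : {set 'I_n}) \sum_(j in J) wsign J j * - cmean B (fun x => w (J :\ j) x * (cpartial j (e J) x)^*)).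
  rewrite /pointwise_inner cmean_sum; last first.
    move=> J _; under eq_fun do rewrite extdE mulr_suml.
    by apply: ccontinuous_sum => j _; under eq_fun do rewrite -mulrA; exact: cZ.
  apply: eq_bigr => J _; under eq_fun do rewrite extdE mulr_suml.
  rewrite cmean_sum; last by move=> j _; under eq_fun do rewrite -mulrA; exact: cZ.
  apply: eq_bigr => j _; under eq_fun do rewrite -mulrA.
  rewrite cmeanZ//; congr (_ * _).
  rewrite (cmean_by_parts Bu j (sw _) (csmooth_conj (se J)) (pw _)).
    by rewrite (cpartial_conj j (se J)).
  by move=> v x Lv; rewrite (pe J).
rewrite sum_delete_insert.
rewrite /pointwise_inner cmean_sum; last first.
  move=> I _; exact: (csmooth_pointwise_continuous _ _ Ow (Omega_all_coform Oe)).
apply: eq_bigr => I _.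
have E x : w I x * (coform e I x)^* =
    \sum_(j | j \notin I) - wsign (j |: I) j * (w I x * (cpartial j (e (j |: I)) x)^*).
  rewrite coformE rmorph_sum mulr_sumr; apply: eq_bigr => j _.
  by rewrite rmorphM rmorphN /= conj_wsign mulrCA.
under [in RHS]eq_fun do rewrite E.
rewrite cmean_sum; last by move=> j _; exact: cZ.
apply: eq_bigr => j jI; rewrite cmeanZ// finset.setU1K//.
by rewrite mulrN mulNr.
Qed.

Lemma L2_innerB w z1 z2 : Omega_all L w -> Omega_all L z1 -> Omega_all L z2 ->
  L2_inner L w (fun I x => z1 I x - z2 I x) = L2_inner L w z1 - L2_inner L w z2.
Proof.
move=> Ow O1 O2; rewrite !L2_innerE -mulrBr; congr (_ * _).
have c1 := csmooth_pointwise_continuous; rewrite -cmeanN; last first.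
  by apply: ccontinuous_sum => I _; exact: c1.
rewrite -cmeanD; last 2 first.
- by apply: ccontinuous_sum => I _; exact: c1.
- by apply: ccontinuousN; apply: ccontinuous_sum => I _; exact: c1.
congr (cmean B _); apply/funext => x; rewrite /pointwise_inner -sumrB.
by apply: eq_bigr => I _; rewrite rmorphB mulrBr.
Qed.

Lemma Omega_allB z1 z2 : Omega_all L z1 -> Omega_all L z2 ->
  Omega_all L (fun I x => z1 I x - z2 I x).
Proof.
move=> O1 O2 I; split.
  have := csmoothD (O1 I).1 (csmoothZ (-1) (O2 I).1).
  by under eq_fun do rewrite mulN1r.
by move=> v x Lv; rewrite (O1 I).2// (O2 I).2.
Qed.

Lemma L2_inner_eq0 w : Omega_all L w -> L2_inner L w w = 0 -> forall I x, w I x = 0.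
Proof.
move=> Ow; rewrite L2_innerE => /eqP; rewrite mulf_eq0 => /orP[/eqP/(congr1 (@complex.Re R))/=|/eqP].
  by move=> /eqP; rewrite normr_eq0 => /eqP d0; move: Bu; rewrite unitmxE unitfE d0 eqxx.
apply: (cmean_norm_eq0 Bu) => I; first exact: csmooth_ccontinuous (Ow I).1.
exact: Omega_all_periodic.
Qed.

(** Two adjoints differ by a form orthogonal to all forms, in particular to
    itself. *)
Lemma codiffE e : Omega_all L e -> codiff L e = coform e.
Proof.
move=> Oe; rewrite /codiff; apply: xget_subset1.
  by split; [exact: Omega_all_coform|move=> w Ow; exact: L2_adjoint].
move=> z1 z2 [q1 H1] [q2 H2].
have O12 := Omega_allB q1 q2.
have z0 : L2_inner L (fun I x => z1 I x - z2 I x) (fun I x => z1 I x - z2 I x) = 0.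
  by rewrite L2_innerB// -H1// -H2// subrr.
apply/funext => I; apply/funext => x; apply/eqP; rewrite -subr_eq0.
by apply/eqP; exact: (L2_inner_eq0 O12 z0).
Qed.

Definition xi_freq k (j : 'I_n) : R[i] := 0 +i* freq B k j.
Definition fcoefs w k I : R[i] := fcoef B (w I) k.

Lemma fcoefs_extd w k J : Omega_all L w ->
  fcoefs (extd w) k J = ext_mul (xi_freq k) (fcoefs w k) J.
Proof.
move=> Ow; have sw I := (Ow I).1; have pw I := Omega_all_periodic I Ow.
have cc I j : ccontinuous (cpartial j (w I)).
  by apply: csmooth_ccontinuous; exact: csmooth_cpartial.
rewrite /fcoefs fcoef_sum//; last first.
  by move=> j _; apply: ccontinuousM => //; exact: ccontinuous_cst.
by apply: eq_bigr => j _; rewrite fcoefZ// fcoef_cpartial// mulrA.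
Qed.

Lemma fcoefs_coform e k I : Omega_all L e ->
  fcoefs (coform e) k I = int_mul (xi_freq k) (fcoefs e k) I.
Proof.
move=> Oe; have se J := (Oe J).1; have pe J := Omega_all_periodic J Oe.
have cc J j : ccontinuous (cpartial j (e J)).
  by apply: csmooth_ccontinuous; exact: csmooth_cpartial.
rewrite /fcoefs coformE fcoef_sum//; last first.
  by move=> j _; apply: ccontinuousM => //; exact: ccontinuous_cst.
rewrite /int_mul -sumrN; apply: eq_bigr => j _.
by rewrite fcoefZ// fcoef_cpartial// mulrA !mulNr.
Qed.

Lemma fcoefs_inj w z : Omega_all L w -> Omega_all L z ->
  (forall k I, fcoefs w k I = fcoefs z k I) -> w = z.
Proof.
move=> Ow Oz H; apply/funext => I; apply/funext => x; apply/eqP; rewrite -subr_eq0; apply/eqP.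
have Od := Omega_allB Ow Oz.
apply: (fcoef_inj Bu (f := fun y => w I y - z I y)).
- exact: csmooth_ccontinuous (Od I).1.
- exact: (Omega_all_periodic I Od).
- move=> k; have cw := csmooth_ccontinuous (Ow I).1; have cz := csmooth_ccontinuous (Oz I).1.
  have := fcoefD B k cw (ccontinuousM (ccontinuous_cst (-1)) cz).
  rewrite fcoefZ// mulN1r.
  have := H k I; rewrite /fcoefs => ->; rewrite subrr => <-.
  by congr fcoef; apply/funext => y; rewrite mulN1r.
Qed.

Section eigenforms.
Context (alpha beta : R).

Lemma F_opE w : Omega_all L w -> F_op alpha beta L w = fun I x =>
  alpha%:C * extd (coform w) I x + beta%:C * coform (extd w) I x.
Proof. by move=> Ow; rewrite /F_op !codiffE//; exact: Omega_all_extd. Qed.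

Lemma Omega_all_lin (a b : R[i]) w z : Omega_all L w -> Omega_all L z ->
  Omega_all L (fun I x => a * w I x + b * z I x).
Proof.
move=> Ow Oz I; split.
  by apply: csmoothD; apply: csmoothZ; [exact: (Ow I).1|exact: (Oz I).1].
by move=> v x Lv; rewrite (Ow I).2// (Oz I).2.
Qed.

Lemma fcoefs_lin (a b : R[i]) w z k I : Omega_all L w -> Omega_all L z ->
  fcoefs (fun I x => a * w I x + b * z I x) k I = a * fcoefs w k I + b * fcoefs z k I.
Proof.
move=> Ow Oz; have cw := csmooth_ccontinuous (Ow I).1; have cz := csmooth_ccontinuous (Oz I).1.
rewrite /fcoefs fcoefD; last 2 first.
- by apply: ccontinuousM => //; exact: ccontinuous_cst.
- by apply: ccontinuousM => //; exact: ccontinuous_cst.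
by rewrite !fcoefZ.
Qed.

(** Both sides of the eigenvalue equation are smooth periodic forms, hence are equal
    iff their Fourier coefficients are. *)
Lemma eigenform_fcoefs (lam : R[i]) w : Omega_all L w ->
  F_op alpha beta L w = lam *: w <->
  forall k I, fsymbol (xi_freq k) alpha%:C beta%:C (fcoefs w k) I = lam * fcoefs w k I.
Proof.
move=> Ow.
have O1 := Omega_all_extd (Omega_all_coform Ow).
have O2 := Omega_all_coform (Omega_all_extd Ow).
have OF := Omega_all_lin alpha%:C beta%:C O1 O2.
have Ol := Omega_all_lin lam 0 Ow Ow.
have lE : lam *: w = (fun I x => lam * w I x + 0 * w I x).
  by apply/funext => I; apply/funext => x; rewrite mul0r addr0.
have FE k I : fcoefs (F_op alpha beta L w) k I = fsymbol (xi_freq k) alpha%:C beta%:C (fcoefs w k) I.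
  rewrite F_opE// fcoefs_lin// fcoefs_extd; last exact: Omega_all_coform.
  rewrite fcoefs_coform; last exact: Omega_all_extd.
  rewrite (_ : fcoefs (coform w) k = int_mul (xi_freq k) (fcoefs w k)); last first.
    by apply/funext => J; exact: fcoefs_coform.
  rewrite (_ : fcoefs (extd w) k = ext_mul (xi_freq k) (fcoefs w k)); last first.
    by apply/funext => J; exact: fcoefs_extd.
  by [].
have lk k I : fcoefs (lam *: w) k I = lam * fcoefs w k I.
  by rewrite lE fcoefs_lin// mul0r addr0.
split=> [Fw k I|H]; first by rewrite -FE Fw lk.
apply: fcoefs_inj; [by rewrite F_opE|by rewrite lE|].
by move=> k I; rewrite FE lk.
Qed.

End eigenforms.

End Codifferential.

(** * Modes with a given Laplace eigenvalue *)
Section Modes.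
Context {R : realType} {n : nat} (B : 'M[R]_n) (Bu : B \in unitmx).
Implicit Types (k : 'rV[int]_n) (z : R[i]).

Definition lapl k : R := \sum_j freq B k j ^+ 2.

Lemma lapl_ge0 k : 0 <= lapl k.
Proof. by apply: sumr_ge0 => j _; exact: sqr_ge0. Qed.

Lemma lapl_eq0 k : (lapl k == 0) = (k == 0).
Proof.
apply/eqP/eqP => [k0|->].
  apply: (freq_eq0 Bu) => j; apply/eqP; rewrite -sqrf_eq0.
  by move/eqP: k0; rewrite psumr_eq0 => [/allP/(_ j (mem_index_enum _))|l _]; [|exact: sqr_ge0].
by apply: big1 => j _; rewrite /freq /dual_phase phase0l expr0n.
Qed.

(** The pairing of the dual vector with the i-th basis vector. *)
Lemma index_freq k i : 2 * pi * (k ord0 i)%:~R = \sum_j B i j * freq B k j.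
Proof.
have := dual_phase_freq B k (delta_mx ord0 i *m B).
rewrite /dual_phase mulmxK// -rowE => H.
transitivity (phase k (delta_mx ord0 i : 'rV[R]_n)).
  rewrite /phase (bigD1 i)//= big1 ?addr0; last first.
    by move=> j ji; rewrite mxE (negPf ji) andbF mulr0.
  by rewrite mxE !eqxx mulr1.
by rewrite H; apply: eq_bigr => j _; rewrite mxE.
Qed.

(** A crude bound for the operator norm of B, made positive by the summand 1. *)
Definition entry_sum : R := 1 + \sum_i \sum_j `|B i j|.

Lemma entry_sum_gt0 : 0 < entry_sum.
Proof. by rewrite ltr_pwDl// sumr_ge0// => i _; rewrite sumr_ge0. Qed.

Lemma index_bound k (e : R) i : (forall j, `|freq B k j| <= e) -> 0 <= e ->
  2 * pi * `|(k ord0 i)%:~R| <= e * entry_sum.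
Proof.
move=> ke e0; rewrite -[2 * pi]ger0_norm; last by rewrite mulr_ge0// pi_ge0.
rewrite -normrM index_freq; apply: (le_trans (ler_norm_sum _ _ _)).
apply: (@le_trans _ _ (\sum_j `|B i j| * e)).
  by apply: ler_sum => j _; rewrite normrM ler_wpM2l.
rewrite -mulr_suml mulrC ler_wpM2l// /entry_sum [X in 1 + X](bigD1 i)//= addrCA lerDl.
by rewrite addr_ge0// sumr_ge0// => l _; rewrite sumr_ge0.
Qed.

Lemma freq_le_lapl k j : freq B k j ^+ 2 <= lapl k.
Proof.
by rewrite /lapl (bigD1 j)//= lerDl sumr_ge0// => l _; exact: sqr_ge0.
Qed.

Lemma finite_bounded_index (M : nat) :
  finite_set [set k : 'rV[int]_n | forall i, `|k ord0 i| <= M%:Z].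
Proof.
pose g (f : {ffun 'I_n -> 'I_(2 * M).+1}) : 'rV[int]_n := \row_i ((f i : nat)%:Z - M%:Z).
apply: (@sub_finite_set _ _ (range g)); last exact: finite_image.
move=> k kM; exists [ffun i => inord `|k ord0 i + M%:Z|] => //.
apply/rowP => i; rewrite mxE ffunE.
have : `|k 0 i| <= M%:Z := kM i.
have -> : k ord0 i = k 0 i by [].
move: (k 0 i) => x xM.
by rewrite inordK; lia.
Qed.

Definition modes z : set 'rV[int]_n := [set k | (lapl k)%:C = z].

(** A bound on the frequency bounds the integer coordinates. *)
Lemma finite_modes z : finite_set (modes z).
Proof.
pose rho := complex.Re z.
have [M HM] : exists M : nat, (1 + `|rho|) * entry_sum <= M%:R.
  exists (Num.bound ((1 + `|rho|) * entry_sum)); apply/ltW/archi_boundP; by apply: mulr_ge0; [exact: addr_ge0|exact/ltW/entry_sum_gt0].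
apply: (sub_finite_set _ (finite_bounded_index M)) => k kz i /=.
have lr : lapl k = rho by rewrite /rho -kz.
(* x^2 <= rho implies |x| <= 1 + |rho| *)
have fe j : `|freq B k j| <= 1 + `|rho|.
  have := freq_le_lapl k j; rewrite lr => h.
  have := ler_norm rho => h2.
  have h3 := normr_ge0 (freq B k j).
  rewrite leNgt; apply/negP => h4.
  have : `|freq B k j| * 1 <= `|freq B k j| * `|freq B k j|.
    by rewrite ler_wpM2l//; have := normr_ge0 rho; lra.
  by rewrite mulr1 -normrM -expr2 ger0_norm ?sqr_ge0//; lra.
have := index_bound i fe (addr_ge0 ler01 (normr_ge0 _)).
move=> /le_trans/(_ HM) H.
have : `|(k ord0 i)%:~R| <= M%:R :> R.
  apply: le_trans H; rewrite ler_peMl// .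
  by have := @pi_ge2 R; lra.
by rewrite -intr_norm -[M%:R]/(M%:Z%:~R) ler_int.
Qed.

Definition mode_count z : nat := #|` fset_set (modes z)|.

Lemma mode_count_eq0 z : (forall k, (lapl k)%:C <> z) -> mode_count z = 0%N.
Proof.
move=> H; rewrite /mode_count (_ : modes z = set0) ?fset_set0//.
by apply/seteqP; split => // k /H.
Qed.

(** A frequency shorter than 1 / entry_sum has integer coordinates of absolute value
    less than 1. *)
Lemma lapl_gap : exists2 d : R, 0 < d & forall k, k != 0 -> d <= lapl k.
Proof.
have C0 := entry_sum_gt0.
exists ((entry_sum^-1) ^+ 2); first by rewrite exprn_gt0// invr_gt0.
move=> k k0; rewrite leNgt; apply/negP => kd; move/negP: k0; apply.
apply/eqP/rowP => i; rewrite mxE.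
have fe j : `|freq B k j| <= entry_sum^-1.
  rewrite -(@ler_pXn2r _ 2)// ?nnegrE ?invr_ge0 ?(ltW C0)//.
  rewrite -normrX ger0_norm ?sqr_ge0//.
  exact: (le_trans (freq_le_lapl k j) (ltW kd)).
have := index_bound i fe; rewrite invr_ge0 (ltW C0) mulVf ?gt_eqF// => /(_ isT) h.
have : `|(k ord0 i)%:~R| < 1 :> R.
  have := @pi_ge2 R; have := normr_ge0 ((k ord0 i)%:~R : R) => h1 h2.
  have h3 : 2 * 2 * `|(k ord0 i)%:~R| <= 2 * pi * `|(k ord0 i)%:~R| :> R.
    by rewrite ler_wpM2r// ler_pM2l.
  by lra.
rewrite -intr_norm -[1]/(1%:~R) ltr_int.
rewrite (_ : k ord0 i = k 0 i)//; lia.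
Qed.

End Modes.

(** * The eigenspaces on p-forms *)
Section Eigenspace.
Context {R : realType} {n : nat} (L : set 'rV[R]_n) (hL : is_lattice L).
Context (alpha beta : R) (halpha : 0 < alpha) (hbeta : 0 < beta) (p : nat) (lam : R[i]).
Implicit Types (w e z : dform R n) (I J A : {set 'I_n}) (k : 'rV[int]_n).
Local Notation B := (lattice_basis L).
Local Notation al := (alpha%:C).
Local Notation be := (beta%:C).

Let Bu : B \in unitmx := (lattice_basisP hL).1.
Let LE : L = Zspan B := (lattice_basisP hL).2.

Lemma mu_xi_freq k : mu (xi_freq L k) = (lapl B k)%:C.
Proof.
rewrite /mu /lapl rmorph_sum -sumrN; apply: eq_bigr => j _.
rewrite /xi_freq; apply: complex_ext; rewrite /= ?oppr0; ring.
Qed.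

Lemma mu_xi_freq_eq0 k : (mu (xi_freq L k) == 0) = (k == 0).
Proof. by rewrite mu_xi_freq -(lapl_eq0 Bu) eq_complex /= eqxx andbT. Qed.

Lemma xi_freq0 k : mu (xi_freq L k) = 0 -> forall j, xi_freq L k j = 0.
Proof.
move=> /eqP; rewrite mu_xi_freq_eq0 => /eqP-> j.
by rewrite /xi_freq /freq /dual_phase phase0l.
Qed.

Let al0 : al != 0. Proof. by rewrite eq_complex /= eqxx andbT gt_eqF. Qed.
Let be0 : be != 0. Proof. by rewrite eq_complex /= eqxx andbT gt_eqF. Qed.

(** The modes that can carry an eigenform for lam.  For lam = 0 this is the zero
    mode alone. *)
Definition spectral_modes : {fset 'rV[int]_n} :=
  (fset_set (modes B (lam / al)) `|` fset_set (modes B (lam / be)))%fset.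
Local Notation S := spectral_modes.

Lemma modesE (a : R[i]) k : a != 0 ->
  (k \in modes B (lam / a)) = (a * mu (xi_freq L k) == lam).
Proof.
move=> a0; rewrite mu_xi_freq; apply/idP/eqP; rewrite inE /modes /=.
  by move=> ->; rewrite mulrC divfK.
by move=> <-; rewrite mulrC mulKf.
Qed.

Lemma spectral_modesP k :
  (k \in S) = (al * mu (xi_freq L k) == lam) || (be * mu (xi_freq L k) == lam).
Proof.
by rewrite in_fsetU !in_fset_set ?modesE//; exact: finite_modes.
Qed.

Local Notation eigp k := (eigproj (xi_freq L k) p al be lam).

Lemma eigproj_notin k v A : k \notin S -> eigp k v A = 0.
Proof.
rewrite spectral_modesP negb_or => /andP[/negPf h1 /negPf h2].
rewrite /eigproj; case: ifPn => [/eqP m0|_]; last by rewrite h1 h2 !mul0r addr0.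
by move: h1; rewrite m0 mulr0 eq_sym => ->; rewrite mul0r.
Qed.

Definition mode_form (i : S * {set 'I_n}) : dform R n :=
  fun A x => (A == i.2)%:R * echar B (val i.1) x.

Definition mode_comb (c : S * {set 'I_n} -> R[i]) : dform R n := \sum_i c i *: mode_form i.

Lemma mode_combE c A : mode_comb c A = fun x => \sum_(k : S) c (k, A) * echar B (val k) x.
Proof.
apply/funext => x; rewrite /mode_comb.
have -> : (\sum_i c i *: mode_form i) A x = \sum_i c i * mode_form i A x.
  by elim/big_rec2 : _ => // i y z _ <-.
rewrite (eq_bigr (fun i => c (i.1, i.2) * mode_form (i.1, i.2) A x)); last by move=> -[].
rewrite -(pair_bigA _ (fun (k : S) J => c (k, J) * mode_form (k, J) A x))/=.
apply: eq_bigr => k _; rewrite (bigD1 A)//= big1 ?addr0; last first.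
  by move=> J JA; rewrite /mode_form/= eq_sym (negPf JA) mul0r mulr0.
by rewrite /mode_form/= eqxx mul1r.
Qed.

Lemma mode_comb_Omega c : Omega_all L (mode_comb c).
Proof.
move=> A; rewrite mode_combE; split.
  by apply: csmooth_sum => k _; apply: csmoothZ; exact: csmooth_echar.
rewrite [X in Defs.periodic X]LE; apply: periodic_sum => k _ v x Lv.
by rewrite (periodic_echar Bu).
Qed.

Lemma fcoefs_mode_comb c k A :
  fcoefs L (mode_comb c) k A = if insub k is Some l then c (l : S, A) else 0.
Proof.
rewrite /fcoefs mode_combE fcoef_sum; last first.
  by move=> l _; apply: ccontinuousM; [exact: ccontinuous_cst|exact: ccontinuous_echar].
have E (l : S) : fcoef B (fun x => c (l, A) * echar B (val l) x) k = c (l, A) * (val l == k)%:R.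
  by rewrite fcoefZ ?(fcoef_echar Bu)//; exact: ccontinuous_echar.
rewrite (eq_bigr _ (fun l _ => E l)).
case: insubP => [l _ lk|kS].
  rewrite (bigD1 l)//= lk eqxx mulr1 big1 ?addr0// => m ml.
  by rewrite -lk (inj_eq val_inj) (negPf ml) mulr0.
rewrite big1// => l _; case: eqP => [lk|_]; last by rewrite mulr0.
by move: kS; rewrite -lk (valP l).
Qed.

Definition mode_proj (c : S * {set 'I_n} -> R[i]) (i : S * {set 'I_n}) : R[i] :=
  eigp (val i.1) (fun A => c (i.1, A)) i.2.

Lemma mode_proj_lin : linop mode_proj.
Proof. by move=> a v w [k A]; rewrite /mode_proj/= eigproj_lin. Qed.

Lemma mode_proj_idem c i : mode_proj (mode_proj c) i = mode_proj c i.
Proof.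
rewrite /mode_proj/= -[RHS]eigproj_idem; congr eigproj; apply/funext => A /=.
Qed.

Lemma mode_form_free (c : S * {set 'I_n} -> R[i]) :
  \sum_i c i *: mode_form i = 0 -> forall i, c i = 0.
Proof.
move=> c0 [k A]; have := fcoefs_mode_comb c (val k) A.
rewrite valK => <-; rewrite /fcoefs /mode_comb c0.
have -> : (0 : dform R n) A = fun x => 0 * echar B 0 x by apply/funext => x; rewrite mul0r.
by rewrite fcoefZ ?mul0r//; exact: ccontinuous_echar.
Qed.

(** An eigenform has the same Fourier coefficients as the combination of modes built
    from them, the coefficients outside spectral_modes being zero. *)
Lemma eigenspaceE :
  eigenspace_on (Omega L p) (F_op alpha beta L) lam =
  [set v | exists c : S * {set 'I_n} -> R[i],
     (forall i, \sum_j c j * mode_proj (ind j) i = c i) /\ v = \sum_i c i *: mode_form i].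
Proof.
apply/seteqP; split => [w [[Ow wp]]|w [c [cP ->]]].
  move=> /(eigenform_fcoefs hL _ _ _ Ow) Fw.
  have eigw k A : eigp k (fcoefs L w k) A = fcoefs L w k A.
    move: A; apply/(eigprojP _ _ _ _ _ (@xi_freq0 k)); split; last exact: Fw.
    move=> J Jp; rewrite /fcoefs wp; last exact/eqP.
    have -> : (0 : 'rV[R]_n -> R[i]) = fun x => 0 * echar B 0 x by apply/funext => x; rewrite mul0r.
    by rewrite fcoefZ ?mul0r//; exact: ccontinuous_echar.
  exists (fun i => fcoefs L w (val i.1) i.2); split.
    by move=> [k A]; rewrite linop_ind; [exact: eigw|exact: mode_proj_lin].
  apply: (fcoefs_inj hL Ow (mode_comb_Omega _)) => k A.
  rewrite fcoefs_mode_comb; case: insubP => [l _ <-//|kS].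
  by rewrite -eigw eigproj_notin.
have Oc := mode_comb_Omega c.
have {}cP i : mode_proj c i = c i by rewrite -linop_ind ?cP//; exact: mode_proj_lin.
have cS k : (forall J, #|J| != p -> fcoefs L (mode_comb c) k J = 0) /\
    (forall J, fsymbol (xi_freq L k) al be (fcoefs L (mode_comb c) k) J = lam * fcoefs L (mode_comb c) k J).
  apply/(eigprojP _ _ _ _ _ (@xi_freq0 k)) => A.
  have [kS|kS] := boolP (k \in S); last first.
    by rewrite eigproj_notin// fcoefs_mode_comb insubN.
  have -> : fcoefs L (mode_comb c) k = fun A => c ([` kS]%fset, A).
    by apply/funext => J; rewrite fcoefs_mode_comb insubT.
  exact: (cP ([` kS]%fset, A)).
split; last by apply/(eigenform_fcoefs hL _ _ _ Oc) => k; exact: (cS k).2.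
split => // A Ap; rewrite -/(mode_comb c) mode_combE; apply/funext => x.
rewrite big1// => k _; have := (cS (val k)).1 A; rewrite fcoefs_mode_comb valK.
by move=> ->; [rewrite mul0r|exact/eqP].
Qed.

(** The trace of mode_proj. *)
Definition eigen_dim : nat := (\sum_(k : S)
  (if (mu (xi_freq L (val k)) == 0)%R then ((lam == 0)%R * 'C(n, p))%N
   else ((al * mu (xi_freq L (val k)) == lam)%R * exact_mult n p +
         (be * mu (xi_freq L (val k)) == lam)%R * coexact_mult n p)%N))%N.

Lemma has_dim_eigenspace :
  has_dim (eigenspace_on (Omega L p) (F_op alpha beta L) lam) eigen_dim.
Proof.
rewrite eigenspaceE; apply: has_dim_idempotent.
- exact: mode_form_free.
- move=> i k; rewrite linop_ind; last exact: mode_proj_lin.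
  exact: mode_proj_idem.
- rewrite (eq_bigr (fun i => mode_proj (ind (i.1, i.2)) (i.1, i.2))); last by move=> -[].
  rewrite -(pair_bigA _ (fun (k : S) J => mode_proj (ind (k, J)) (k, J)))/=.
  rewrite /eigen_dim natr_sum; apply: eq_bigr => k _.
  rewrite -eigproj_trace; apply: eq_bigr => J _; rewrite /mode_proj /=.
  congr eigproj; apply/funext => A; rewrite /ind.
  by rewrite xpair_eqE eqxx.
Qed.

Lemma sum_modes (a : R[i]) : a != 0 -> {subset fset_set (modes B (lam / a)) <= S} ->
  (\sum_(k : S) (a * mu (xi_freq L (val k)) == lam)%R)%N = mode_count B (lam / a).
Proof.
move=> a0 sub; rewrite /mode_count cardfE -sum1_card.
rewrite -[LHS](big_seq_fsetE addn S xpredT (fun k => ((a * mu (xi_freq L k) == lam)%R : nat)))/=.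
rewrite -[RHS](big_seq_fsetE addn _ xpredT (fun=> 1%N))/=.
have inA k : (k \in fset_set (modes B (lam / a))) = (a * mu (xi_freq L k) == lam).
  rewrite in_fset_set; last exact: finite_modes.
  by rewrite modesE.
transitivity (\sum_(k <- fset_set (modes B (lam / a))) ((a * mu (xi_freq L k) == lam)%R : nat))%N.
  apply/esym/big_fset_incl; first exact/fsubsetP.
  by move=> k _; rewrite inA => /negPf->.
by apply: eq_big_seq => k; rewrite inA => ->.
Qed.

Lemma eigen_dimE : eigen_dim =
  if lam == 0 then 'C(n, p)
  else (exact_mult n p * mode_count B (lam / al) + coexact_mult n p * mode_count B (lam / be))%N.
Proof.
rewrite /eigen_dim; case: ifPn => l0.
  have S0 k : (k \in S) = (k == 0).
    rewrite spectral_modesP (eqP l0) !mulf_eq0 (negPf al0) (negPf be0)/= orbb.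
    exact: mu_xi_freq_eq0.
  have h0 : (0 : 'rV[int]_n) \in S by rewrite S0.
  rewrite (bigD1 [` h0]%fset)//= mu_xi_freq_eq0 eqxx mul1n big1 ?addn0//.
  move=> k; rewrite -(inj_eq val_inj)/= -S0 => /negP; case.
  exact: valP.
transitivity (\sum_(k : S) ((al * mu (xi_freq L (val k)) == lam)%R * exact_mult n p +
         (be * mu (xi_freq L (val k)) == lam)%R * coexact_mult n p))%N.
  apply: eq_bigr => k _; case: ifPn => // /eqP m0.
  by rewrite m0 !mulr0 eq_sym (negPf l0).
rewrite big_split/= -!big_distrl/= !sum_modes//.
- by rewrite mulnC [X in (_ + X)%N]mulnC.
- by move=> k kS; rewrite in_fsetU kS orbT.
- by move=> k kS; rewrite in_fsetU kS.
Qed.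

End Eigenspace.

(** * Comparison of the spectra *)
Section Spectra.
Context {R : realType} {n : nat}.
Implicit Types (L : set 'rV[R]_n) (alpha beta x : R) (lam z : R[i]).

Lemma F_spectrumE L alpha beta p lam : is_lattice L -> 0 < alpha -> 0 < beta ->
  F_spectrum alpha beta p L lam = Some (if lam == 0 then 'C(n, p) else
    (exact_mult n p * mode_count (lattice_basis L) (lam / alpha%:C) +
     coexact_mult n p * mode_count (lattice_basis L) (lam / beta%:C))%N).
Proof.
move=> hL a0 b0; rewrite /F_spectrum /spectrum.
by rewrite (dimensionE (has_dim_eigenspace hL a0 b0 p lam)) eigen_dimE.
Qed.

(** On functions the codifferential vanishes. *)
Lemma F_op_functions L w : is_lattice L -> Omega L 0 w -> F_op 1 1 L w = Delta0 L w.
Proof.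
move=> hL [Ow w0]; rewrite /Delta0 /F_op !scale1r codiffE//.
have c0 j (f : 'rV[R]_n -> R[i]) : f = 0 -> cpartial j f = 0.
  by move=> ->; exact: cpartial0.
have -> : coform w = 0.
  apply/funext => I; apply/funext => x; rewrite /coform big1 ?oppr0// => j jI.
  rewrite c0 ?mulr0//; apply: w0; apply/eqP.
  by rewrite cardsU1 jI.
rewrite (_ : extd 0 = 0) ?add0r//.
apply/funext => J; apply/funext => x; rewrite /extd big1// => j jJ.
by rewrite c0 ?mulr0.
Qed.

Lemma Delta0_spectrumE L lam : is_lattice L ->
  Delta0_spectrum L lam = Some (if lam == 0 then 1%N else mode_count (lattice_basis L) lam).
Proof.
move=> hL; have <- : F_spectrum 1 1 0 L lam = Delta0_spectrum L lam.
  rewrite /F_spectrum /Delta0_spectrum /spectrum; congr dimension.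
  apply/seteqP; split => w [Ow]; first by rewrite F_op_functions.
  by rewrite -F_op_functions.
rewrite F_spectrumE// bin0 /exact_mult /coexact_mult !bin0 subnn mul0n mul1n add0n.
by rewrite divr1.
Qed.

(** If f1 and f2 agree at r x, the relation makes them agree at x; and r^m x < d
    for m large. *)
Lemma scaling_unique (f1 f2 : R -> nat) (a b : nat) (r d : R) : (0 < a)%N ->
  0 < r < 1 -> 0 < d ->
  (forall x, 0 < x -> (a * f1 x + b * f1 (r * x)%R)%N = (a * f2 x + b * f2 (r * x)%R)%N) ->
  (forall x, 0 < x < d -> f1 x = f2 x) ->
  forall x, 0 < x -> f1 x = f2 x.
Proof.
move=> a0 /andP[r0 r1] d0 H Hd.
have Hm m : forall x, 0 < x -> x * r ^+ m < d -> f1 x = f2 x.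
  elim: m => [|m IH] x x0; first by rewrite expr0 mulr1 => xd; apply: Hd; rewrite x0.
  rewrite exprS mulrA => xd.
  have := H x x0; rewrite (IH (r * x)) ?mulr_gt0//; last by rewrite [r * x]mulrC.
  by move=> /addIn/eqP; rewrite eqn_pmul2l// => /eqP.
move=> x x0.
have cv : geometric x r @ \oo --> 0 by apply: cvg_geometric; rewrite ger0_norm ?ltW.
have [m _ mP] := cvgr_lt 0 cv d d0.
by apply: (Hm m x x0); exact: (mP m (leqnn m)).
Qed.

(** Reduction to scaling_unique with the smaller of alpha / beta and beta / alpha as
    ratio; for alpha = beta the relation can be divided by a + b, and if beta < alpha
    the roles of a and b are exchanged, which needs b > 0. *)
Lemma two_scale_unique (f1 f2 : R -> nat) (a b : nat) alpha beta (d : R) :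
  0 < alpha -> 0 < beta -> (0 < a)%N -> 0 < d ->
  (forall x, 0 < x -> (a * f1 (x / alpha)%R + b * f1 (x / beta)%R)%N =
                      (a * f2 (x / alpha)%R + b * f2 (x / beta)%R)%N) ->
  (forall x, 0 < x < d -> f1 x = f2 x) ->
  forall x, 0 < x -> f1 x = f2 x.
Proof.
move=> al0 be0 a0 d0 H Hd x.
have mulK (u y : R) : 0 < u -> u * y / u = y.
  by move=> u0; rewrite mulrAC divff ?mul1r// gt_eqF.
have [ab|ab|ab] := ltgtP alpha beta.
- apply: (scaling_unique (r := alpha / beta) (b := b) a0 _ d0 _ Hd).
    by rewrite divr_gt0//= ltr_pdivrMr// mul1r.
  move=> y y0; have := H (alpha * y) (mulr_gt0 al0 y0).
  by rewrite mulK// mulrAC.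
- have [b0|b0] := posnP b.
    move=> x0; have := H (alpha * x) (mulr_gt0 al0 x0).
    rewrite b0 !mul0n !addn0 mulK//.
    by move=> /eqP; rewrite eqn_pmul2l// => /eqP.
  apply: (scaling_unique (r := beta / alpha) (b := a) b0 _ d0 _ Hd).
    by rewrite divr_gt0//= ltr_pdivrMr// mul1r.
  move=> y y0; have := H (beta * y) (mulr_gt0 be0 y0).
  by rewrite mulK// mulrAC addnC [in RHS]addnC.
- move=> x0; have := H (alpha * x) (mulr_gt0 al0 x0).
  rewrite -ab mulK// -!mulnDl => /eqP.
  by rewrite eqn_pmul2l ?addn_gt0 ?a0// => /eqP.
Qed.

Lemma mode_count_nonpos L z : is_lattice L -> z != 0 -> (forall x : R, 0 < x -> z != x%:C) ->
  mode_count (lattice_basis L) z = 0%N.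
Proof.
move=> hL z0 zP; apply: mode_count_eq0 => k kz.
have : 0 <= lapl (lattice_basis L) k by exact: lapl_ge0.
rewrite le_eqVlt => /predU1P[k0|/zP]; last by rewrite kz eqxx.
by move: z0; rewrite -kz -k0 eqxx.
Qed.

Lemma mode_count_small L : is_lattice L -> exists2 d : R, 0 < d &
  forall x : R, 0 < x < d -> mode_count (lattice_basis L) x%:C = 0%N.
Proof.
move=> hL; have Bu := (lattice_basisP hL).1.
have [d d0 dP] := lapl_gap Bu; exists d => // x /andP[x0 xd].
apply: mode_count_eq0 => k [kx]; have [k0|/dP] := eqVneq k 0.
  by move: x0; rewrite -kx k0 (_ : lapl _ 0 = 0) ?ltxx//; apply/eqP; rewrite lapl_eq0.
by rewrite kx leNgt xd.
Qed.

End Spectra.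

Theorem theorem3p16 (R : realType) (n p : nat) (L1 L2 : set 'rV[R]_n)
    (alpha beta : R)
    (hL1 : is_lattice L1) (hL2 : is_lattice L2)
    (halpha : 0 < alpha) (hbeta : 0 < beta) (hp : (1 <= p <= n)%N) :
  isospectral (F_spectrum alpha beta p L1) (F_spectrum alpha beta p L2) <->
  isospectral (Delta0_spectrum L1) (Delta0_spectrum L2).
Proof.
have F1 := fun lam => F_spectrumE p lam hL1 halpha hbeta.
have F2 := fun lam => F_spectrumE p lam hL2 halpha hbeta.
have D1 := fun lam => Delta0_spectrumE lam hL1.
have D2 := fun lam => Delta0_spectrumE lam hL2.
have real_neq0 (a : R) : 0 < a -> a%:C != 0.
  by move=> a0; rewrite eq_complex/= eqxx andbT gt_eqF.
split=> H lam; last first.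
  have HN (z : R[i]) : z != 0 -> mode_count (lattice_basis L1) z = mode_count (lattice_basis L2) z.
    by move=> z0; have := H z; rewrite D1 D2 (negPf z0) => -[].
  have quo_neq0 (a : R) : 0 < a -> lam != 0 -> lam / a%:C != 0.
    by move=> a0 l0; rewrite mulf_neq0// invr_eq0 real_neq0.
  rewrite F1 F2; congr Some; case: ifPn => // l0.
  by rewrite (HN _ (quo_neq0 _ halpha l0)) (HN _ (quo_neq0 _ hbeta l0)).
rewrite D1 D2; congr Some; case: ifPn => // l0.
have a0 : (0 < exact_mult n p)%N.
  case/andP: hp; clear; case: p => // q _; case: n => // m qm.
  by rewrite /exact_mult/= binS addKn bin_gt0.
have [d1 d10 d1P] := mode_count_small hL1; have [d2 d20 d2P] := mode_count_small hL2.
have d0 : 0 < Num.min d1 d2 by rewrite lt_min d10.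
have key (x : R) : 0 < x -> mode_count (lattice_basis L1) x%:C = mode_count (lattice_basis L2) x%:C.
  apply: (two_scale_unique (f1 := fun y => mode_count (lattice_basis L1) y%:C)
    (f2 := fun y => mode_count (lattice_basis L2) y%:C) (b := coexact_mult n p) halpha hbeta a0 d0).
    move=> y y0; have := H y%:C; rewrite F1 F2 (negPf (real_neq0 _ y0)) => -[].
    by rewrite -!fmorph_div.
  by move=> y; rewrite lt_min => /and3P[y0 y1 y2]; rewrite d1P ?d2P ?y0.
have [[x [x0 ->]]|nx] := pselect (exists x : R, 0 < x /\ lam = x%:C); first exact: key.
have nx' (x : R) : 0 < x -> lam != x%:C.
  by move=> x0; apply/eqP => E; apply: nx; exists x.
by rewrite (mode_count_nonpos hL1 l0 nx') (mode_count_nonpos hL2 l0 nx').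
Qed.
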